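(* Let $R=\bigoplus_{n\in\mathbb{Z}}R_n$ be a $\mathbb{Z}$-graded ring which is right artinian. Let $G_R$ be the supremum of the graded lengths of the finitely generated indecomposable graded right $R$-modules. If $G_R<\infty$, then every finitely generated right $R$-module is gradable. Consequently, $R$ has finite representation type if and only if there are, up to isomorphism, only finitely many finitely generated indecomposable gradable right $R$-modules; and in this case every finitely generated right $R$-module is gradable.
   Context: Rings are associative with unit; ''graded'' means $\mathbb{Z}$-graded. A graded right artinian ring is a right artinian ring $R$ with a grading $R=\bigoplus_{n\in\mathbb{Z}}R_n$, $R_iR_j\subseteq R_{i+j}$. A graded right $R$-module is a right $R$-module with a decomposition $M=\bigoplus_{n\in\mathbb{Z}}M_n$ into abelian groups with $M_iR_j\subseteq M_{i+j}$ for all $i,j$; morphisms of graded modules are $R$-linear maps $f$ with $f(M_n)\subseteq N_n$ for all $n$, and ''indecomposable'' for a graded module means indecomposable in the category of graded modules. The graded length of a nonzero graded module $M$ is $\sup\{n\mid M_n\neq0\}-\inf\{n\mid M_n\neq 0\}+1\in\mathbb{N}\cup\{\infty\}$. A right $R$-module is gradable if it is isomorphic to the underlying $R$-module of some graded right $R$-module. $R$ has finite representation type if there are only finitely many finitely generated indecomposable right $R$-modules up to isomorphism. *)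

(* Defs.v *)
From HB Require Import structures.
From mathcomp Require Import all_boot all_order all_algebra finmap.
From mathcomp Require Import boolp classical_sets constructive_ereal.

Set Implicit Arguments.
Unset Strict Implicit.
Unset Printing Implicit Defensive.

Import Order.TTheory GRing.Theory Num.Theory.

Local Open Scope ring_scope.
Local Open Scope classical_set_scope.

(* Right R-modules are left modules over the converse ring: v . r is written
   (r : R^c) *: v, so that (v . r) . s = v . (r * s). The class pzRingType of
   associative unital rings includes the zero ring. *)
Notation rightModType R := (lmodType (GRing.converse R)).

Definition ract (R : pzRingType) (M : rightModType R) (v : M) (r : R) : M :=
  (r : GRing.converse R) *: v.

(* A family indexed by all of int can only be summed when it is finitely
   supported; such families are the elements of {fsfun int -> V with 0}. *)
Definition fsfun_sum (V : zmodType) (c : {fsfun int -> V with 0}) : V :=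
  \sum_(n <- finsupp c) c n.

(* V is the internal direct sum of the subgroups A n. *)
Definition direct_sum (V : zmodType) (A : int -> {pred V}) : Prop :=
  (forall n, zmod_closed (A n)) /\
  (forall v : V, exists! c : {fsfun int -> V with 0},
     (forall n, c n \in A n) /\ v = fsfun_sum c).

Definition ring_grading (R : pzRingType) (Rgr : int -> {pred R}) : Prop :=
  direct_sum Rgr /\
  (forall i j x y, x \in Rgr i -> y \in Rgr j -> x * y \in Rgr (i + j)).

Definition right_ideal (R : pzRingType) (I : {pred R}) : Prop :=
  zmod_closed I /\ (forall x r, x \in I -> x * r \in I).

Definition right_artinian (R : pzRingType) : Prop :=
  forall I : nat -> {pred R},
    (forall n, right_ideal (I n)) ->
    (forall n, {subset I n.+1 <= I n}) ->
    exists n, forall m, (n <= m)%N -> I m =i I n.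

Definition finitely_generated (R : pzRingType) (M : rightModType R) : Prop :=
  exists (k : nat) (g : 'I_k -> M), forall v : M,
    exists a : 'I_k -> R, v = \sum_(i < k) ract (g i) (a i).

Definition nonzero (V : zmodType) : Prop := exists v : V, v != 0.

Definition internal_dsum (V : zmodType) (A B : {pred V}) : Prop :=
  (forall v, exists a b, [/\ a \in A, b \in B & v = a + b]) /\
  (forall v, v \in A -> v \in B -> v = 0).

Definition indecomposable (R : pzRingType) (M : rightModType R) : Prop :=
  nonzero M /\
  forall A B : {pred M}, submod_closed A -> submod_closed B ->
    internal_dsum A B -> A =i pred1 0 \/ B =i pred1 0.

Definition module_iso (R : pzRingType) (M N : rightModType R) : Prop :=
  exists f : {linear M -> N}, bijective f.

Record gradedModule (R : pzRingType) (Rgr : int -> {pred R}) := GradedModule {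
  gm_sort :> rightModType R;
  gm_comp : int -> {pred gm_sort};
  gm_direct_sum : direct_sum gm_comp;
  gm_ract : forall i j (v : gm_sort) (r : R),
    v \in gm_comp i -> r \in Rgr j -> ract v r \in gm_comp (i + j)
}.
Arguments gm_comp {R Rgr} g n _.

Definition graded_submodule (R : pzRingType) (Rgr : int -> {pred R})
    (M : gradedModule Rgr) (A : {pred M}) : Prop :=
  submod_closed A /\
  (forall v, v \in A -> exists c : {fsfun int -> M with 0},
     (forall n, c n \in A /\ c n \in gm_comp M n) /\ v = fsfun_sum c).

(* Direct summands in the category of graded modules are graded submodules. *)
Definition graded_indecomposable (R : pzRingType) (Rgr : int -> {pred R})
    (M : gradedModule Rgr) : Prop :=
  nonzero M /\
  forall A B : {pred M}, graded_submodule A -> graded_submodule B ->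
    internal_dsum A B -> A =i pred1 0 \/ B =i pred1 0.

Definition degrees (R : pzRingType) (Rgr : int -> {pred R})
    (M : gradedModule Rgr) : set int :=
  [set n | exists2 v : M, v \in gm_comp M n & v != 0].

(* The extended integers \bar int are a complete linear order, so the suprema
   and infima below always exist; the default values only serve for the empty
   set. If M is nonzero, then degrees M is nonempty, so the supremum is not -oo,
   the infimum is not +oo, and the difference is a positive integer or +oo. *)
Definition graded_length (R : pzRingType) (Rgr : int -> {pred R})
    (M : gradedModule Rgr) : \bar int :=
  (supremum -oo (EFin @` degrees M) - infimum +oo (EFin @` degrees M) + 1%:E)%E.

Definition sup_graded_length (R : pzRingType) (Rgr : int -> {pred R}) :
    \bar int :=
  supremum -oo%E [set l | exists M : gradedModule Rgr,
    [/\ finitely_generated M, graded_indecomposable M & l = graded_length M]].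

Definition gradable (R : pzRingType) (Rgr : int -> {pred R})
    (M : rightModType R) : Prop :=
  exists N : gradedModule Rgr, module_iso M N.

Definition finitely_many_up_to_iso (R : pzRingType)
    (P : rightModType R -> Prop) : Prop :=
  exists (k : nat) (N : 'I_k -> rightModType R),
    forall M : rightModType R, P M -> exists i, module_iso M (N i).

Definition finite_representation_type (R : pzRingType) : Prop :=
  finitely_many_up_to_iso
    (fun M : rightModType R => finitely_generated M /\ indecomposable M).

(* Main.v *)
Require Import Defs.
From HB Require Import structures.
From mathcomp Require Import all_boot all_order all_algebra finmap.
From mathcomp Require Import boolp classical_sets functions constructive_ereal.
From mathcomp Require Import zify.

(** The idea is to show that a bound G on the lengths of the indecomposable graded
    modules makes every finitely generated module M a direct summand of a
    graded one. Consider the graded module with a copy of M in every degree, on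
    which R acts by shifting copies, and its finitely generated graded submodule
    N generated by the copies in a long window of degrees. In a decomposition of
    N into indecomposables, each summand lies in a range of G degrees; so
    the projection onto the summands that reach down to a given degree is the
    identity in low degrees and zero in high degrees (cut_endomorphism).
    Extended by 1 and 0 it is a family P n of endomorphisms of the abelian group
    M, compatible with the action of R. The shifted family P (n - 1) is
    compatible too, hence so is the finitely supported family
    P (n - 1) - P n, and its sum telescopes to 1. Thus the identity of M is the
    composite of v |-> (P (n - 1) v - P n v)_n, from M to N, and of the sum of
    components, from N to M (retract_of_window).

    A summand of a graded module is gradable by a Krull-Schmidt argument. Over a
    right artinian ring finitely generated modules have finite length
    (artinian_fgsub, the Hopkins-Levitzki theorem), so indecomposable ones have
    local endomorphism rings (bij_add). A graded indecomposable module is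
    indecomposable (idempotent_trivial): an endomorphism with bijective
    component of degree 0 is injective, by Gaussian elimination on the matrix of
    its homogeneous components, since a composite of maps of degrees d and - d
    with d nonzero is never bijective (elimination). So an indecomposable summand of M
    is isomorphic to a graded summand of N (graded_retract), and the gradings of
    the summands of M add up (graded_of_length_bound).

    If there are only finitely many indecomposable gradable modules, then the
    graded lengths are bounded, because the grading of an indecomposable module
    is unique up to a shift (iso_degrees); the other two assertions follow. Both
    there and in the window argument it matters that a right artinian graded
    ring is concentrated in finitely many degrees (ring_supp_bound), so that
    finitely generated graded modules are as well. *)

Set Implicit Arguments.
Unset Strict Implicit.
Unset Printing Implicit Defensive.

Import Order.TTheory GRing.Theory Num.Theory.

Local Open Scope ring_scope.
Local Open Scope classical_set_scope.

Local Notation "v *> r" := (ract v r) (at level 40, left associativity) : ring_scope.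

(** * Right modules and chain conditions *)

Section RightAction.
Variables (R : pzRingType) (M : rightModType R).
Implicit Types (v w : M) (r s : R).

Lemma ractDl v w r : (v + w) *> r = v *> r + w *> r.
Proof. exact: scalerDr. Qed.
Lemma ractDr v r s : v *> (r + s) = v *> r + v *> s.
Proof. exact: (@scalerDl (GRing.converse R)). Qed.
Lemma ractA v r s : v *> (r * s) = v *> r *> s.
Proof. by rewrite /ract scalerA. Qed.
Lemma ract1 v : v *> 1 = v.
Proof. exact: scale1r. Qed.
Lemma ract0l r : (0 : M) *> r = 0.
Proof. exact: scaler0. Qed.
Lemma ract0r v : v *> 0 = 0.
Proof. exact: (@scale0r (GRing.converse R)). Qed.
Lemma ractNl v r : (- v) *> r = - (v *> r).
Proof. exact: scalerN. Qed.
Lemma ractNr v r : v *> (- r) = - (v *> r).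
Proof. exact: (@scaleNr (GRing.converse R)). Qed.
Lemma ractBl v w r : (v - w) *> r = v *> r - w *> r.
Proof. by rewrite ractDl ractNl. Qed.
Lemma ractBr v r s : v *> (r - s) = v *> r - v *> s.
Proof. by rewrite ractDr ractNr. Qed.
Lemma ract_suml I (l : seq I) (P : pred I) (F : I -> M) r :
  (\sum_(i <- l | P i) F i) *> r = \sum_(i <- l | P i) F i *> r.
Proof. exact: scaler_sumr. Qed.
Lemma ract_sumr I (l : seq I) (P : pred I) (F : I -> R) v :
  v *> (\sum_(i <- l | P i) F i) = \sum_(i <- l | P i) v *> F i.
Proof. exact: (@scaler_suml (GRing.converse R)). Qed.

Definition submod (A : set M) : Prop :=
  [/\ A 0, forall x y, A x -> A y -> A (x + y) & forall x r, A x -> A (x *> r)].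

Lemma submod0 A : submod A -> A 0. Proof. by case. Qed.
Lemma submodD A x y : submod A -> A x -> A y -> A (x + y).
Proof. by case=> _ h _; apply: h. Qed.
Lemma submodM A x r : submod A -> A x -> A (x *> r).
Proof. by case=> _ _; apply. Qed.
Lemma submodN A x : submod A -> A x -> A (- x).
Proof.
by move=> sA Ax; rewrite -[x]ract1 -ractNr; apply: submodM.
Qed.
Lemma submodB A x y : submod A -> A x -> A y -> A (x - y).
Proof. by move=> sA Ax Ay; apply: submodD => //; apply: submodN. Qed.
Lemma submodBr A x y : submod A -> A (x - y) -> A y -> A x.
Proof. by move=> sA Axy Ay; rewrite -[x](subrK y); apply: submodD. Qed.
Lemma submod_sum A I (l : seq I) (P : pred I) F : submod A ->
  (forall i, P i -> A (F i)) -> A (\sum_(i <- l | P i) F i).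
Proof.
by move=> sA AF; elim/big_ind : _ => //; [case: sA|move=> x y; apply: submodD].
Qed.
Lemma submod_sum_seq A (I : eqType) (l : seq I) F : submod A ->
  (forall i, i \in l -> A (F i)) -> A (\sum_(i <- l) F i).
Proof.
move=> sA AF; rewrite big_seq; exact: submod_sum.
Qed.

Lemma submodI A B : submod A -> submod B -> submod (A `&` B).
Proof.
move=> sA sB; split; first by split; apply: submod0.
  by move=> x y [? ?] [? ?]; split; apply: submodD.
by move=> x r [? ?]; split; apply: submodM.
Qed.

Definition addcyc (A : set M) (x : M) : set M :=
  [set v | exists a r, A a /\ v = a + x *> r].

Lemma submod_addcyc A x : submod A -> submod (addcyc A x).
Proof.
move=> sA; split.
- by exists 0, 0; split; [exact: submod0|rewrite ract0r addr0].
- move=> _ _ [a [r [Aa ->]]] [b [s [Ab ->]]]; exists (a + b), (r + s).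
  by split; [exact: submodD|rewrite ractDr addrACA].
- move=> _ t [a [r [Aa ->]]]; exists (a *> t), (r * t).
  by split; [exact: submodM|rewrite ractDl ractA].
Qed.
Lemma sub_addcyc A x : A `<=` addcyc A x.
Proof. by move=> a Aa; exists a, 0; rewrite ract0r addr0. Qed.
Lemma addcyc_gen A x : submod A -> addcyc A x x.
Proof.
by move=> sA; exists 0, 1; rewrite ract1 add0r; split=> //; apply: submod0.
Qed.
Lemma addcyc_min A B x : submod B -> A `<=` B -> B x -> addcyc A x `<=` B.
Proof.
by move=> sB AB Bx _ [a [r [Aa ->]]]; apply: submodD; [|apply: AB|apply: submodM].
Qed.

Definition artinian : Prop := forall A : nat -> set M,
  (forall n, submod (A n)) -> (forall n, A n.+1 `<=` A n) ->
  exists n, forall m, (n <= m)%N -> A n `<=` A m.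

Definition noetherian : Prop := forall A : nat -> set M,
  (forall n, submod (A n)) -> (forall n, A n `<=` A n.+1) ->
  exists n, forall m, A m `<=` A n.

Lemma artinian_min (P : set (set M)) : artinian ->
  (exists A, submod A /\ P A) ->
  exists A, [/\ submod A, P A & forall B, submod B -> P B -> B `<=` A -> A `<=` B].
Proof.
move=> art [A0 hA0]; apply: contrapT => hno.
have step (A : {A | submod A /\ P A}) :
    exists B : {B | submod B /\ P B}, sval B `<=` sval A /\ ~ sval A `<=` sval B.
  case: A => A [sA PA] /=; apply: contrapT => hB; apply: hno; exists A.
  split=> // B sB PB BA; apply: contrapT => nAB; apply: hB.
  by exists (exist _ B (conj sB PB)).
have [f hf] := choice step.
pose A n := sval (iter n f (exist _ A0 hA0)).
have [n hn] : exists n, forall m, (n <= m)%N -> A n `<=` A m.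
  apply: art => n; first by case: (svalP (iter n f (exist _ A0 hA0))).
  by rewrite /A iterS; case: (hf (iter n f (exist _ A0 hA0))).
have /= := hn n.+1 (leqnSn n).
by rewrite /A iterS; case: (hf (iter n f (exist _ A0 hA0))).
Qed.

Lemma noetherian_max (P : set (set M)) : noetherian ->
  (exists A, submod A /\ P A) ->
  exists A, [/\ submod A, P A & forall B, submod B -> P B -> A `<=` B -> B `<=` A].
Proof.
move=> noe [A0 hA0]; apply: contrapT => hno.
have step (A : {A | submod A /\ P A}) :
    exists B : {B | submod B /\ P B}, sval A `<=` sval B /\ ~ sval B `<=` sval A.
  case: A => A [sA PA] /=; apply: contrapT => hB; apply: hno; exists A.
  split=> // B sB PB AB; apply: contrapT => nBA; apply: hB.
  by exists (exist _ B (conj sB PB)).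
have [f hf] := choice step.
pose A n := sval (iter n f (exist _ A0 hA0)).
have [n hn] : exists n, forall m, A m `<=` A n.
  apply: noe => n; first by case: (svalP (iter n f (exist _ A0 hA0))).
  by rewrite /A iterS; case: (hf (iter n f (exist _ A0 hA0))).
have /= := hn n.+1.
by rewrite /A iterS; case: (hf (iter n f (exist _ A0 hA0))).
Qed.

(** Finite generation by a universal property, so that no coefficients need to
    be handled. *)
Definition fgsub (A : set M) : Prop := exists s : seq M,
  (forall x, x \in s -> A x) /\
  forall B, submod B -> (forall x, x \in s -> B x) -> A `<=` B.

Lemma noetherian_of_fgsub : (forall A, submod A -> fgsub A) -> noetherian.
Proof.
move=> fg A sA incA.
have homA m n : (m <= n)%N -> A m `<=` A n.
  elim: n => [|n IH]; first by rewrite leqn0 => /eqP->.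
  rewrite leq_eqVlt ltnS => /orP[/eqP->//|/IH Amn] x Ax.
  by apply: incA; apply: Amn.
pose U := [set x | exists n, A n x].
have sU : submod U.
  split; first by exists 0%N; apply: submod0.
    move=> x y [n Ax] [m Ay]; exists (maxn n m); apply: submodD => //.
      by apply: homA Ax; rewrite leq_maxl.
    by apply: homA Ay; rewrite leq_maxr.
  by move=> x r [n Ax]; exists n; apply: submodM.
have [s [sU' hs]] := fg U sU.
have [n hn] : exists n, forall x, x \in s -> A n x.
  elim: s sU' {hs} => [|x s IH] sU'; first by exists 0%N.
  have [|n hn] := IH; first by move=> y ys; apply: sU'; rewrite inE ys orbT.
  have [m Am] := sU' x (mem_head _ _).
  exists (maxn n m) => y; rewrite inE => /orP[/eqP->|/hn An].
    by apply: homA Am; rewrite leq_maxr.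
  by apply: homA An; rewrite leq_maxl.
exists n => m x Ax; apply: (hs (A n)) => //; by exists m.
Qed.

End RightAction.

Section FgArtinian.
Variable R : pzRingType.

(** R as a right module over itself. The ring structure found on this type by
    inference is that of the converse ring, with the product reversed, whence
    the casts to R around products of its elements. *)
Definition regr : rightModType R := ((GRing.converse R)^o)%type.

Lemma regr_artinian : right_artinian R -> artinian regr.
Proof.
move=> art A sA decA.
have [||n hn] := art (fun n : nat => [pred x : R | `[< A n (x : regr) >] ]).
- move=> n; split; last first.
    by move=> x r /asboolP Ax; apply/asboolP; exact: (@submodM R regr (A n) x r (sA n) Ax).
  split=> [|x y /asboolP Ax /asboolP Ay]; apply/asboolP; first exact: submod0 (sA n).
  exact: (@submodB R regr (A n) x y (sA n) Ax Ay).
- by move=> n x /asboolP Ax; apply/asboolP; apply: decA.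
exists n => m nm x Ax; have /(_ x) := hn m nm.
by rewrite !inE => e; apply/asboolP; rewrite e; apply/asboolP.
Qed.

Lemma fg_artinian (M : rightModType R) :
  right_artinian R -> finitely_generated M -> artinian M.
Proof.
move=> /regr_artinian art [k [g hg]] A sA decA.
have homA m n : (m <= n)%N -> A n `<=` A m.
  elim: n => [|n IH]; first by rewrite leqn0 => /eqP->.
  rewrite leq_eqVlt ltnS => /orP[/eqP->//|/IH Amn] x Ax.
  by apply: Amn; apply: decA.
pose S j := [set v : M | exists a : 'I_k -> R, v = \sum_(i < k | (i < j)%N) g i *> a i].
have sS j : submod (S j).
  split; first by exists (fun=> 0); rewrite big1 // => i _; rewrite ract0r.
    move=> _ _ [a ->] [b ->]; exists (fun i => a i + b i).
    by rewrite -big_split; apply: eq_bigr => i _; rewrite ractDr.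
  move=> _ r [a ->]; exists (fun i => a i * r).
  by rewrite ract_suml; apply: eq_bigr => i _; rewrite ractA.
have SS j (hj : (j < k)%N) v : S j.+1 v -> exists m r, S j m /\ v = m + g (Ordinal hj) *> r.
  move=> [a ->]; exists (\sum_(i < k | (i < j)%N) g i *> a i), (a (Ordinal hj)).
  split; first by exists a.
  rewrite (bigD1 (Ordinal hj)) //= addrC; congr (_ + _); apply: eq_bigl => i.
  by rewrite -val_eqE /= ltnS ltn_neqAle andbC.
suff H j : (j <= k)%N -> exists n, forall m, (n <= m)%N -> A n `&` S j `<=` A m.
  have [n hn] := H k (leqnn k); exists n => m nm x Ax; apply: (hn m nm); split=> //.
  have [a ->] := hg x; exists a; apply: eq_bigl => i; by rewrite ltn_ord.
elim: j => [_|j IH jk].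
  exists 0%N => m _ x [_ [a ->]]; rewrite big1 => [|i]; [exact: submod0|by rewrite ltn0].
have [n1 h1] := IH (ltnW jk).
pose g0 := g (Ordinal jk).
pose I n := [set r : regr | exists m, S j m /\ A n (m + g0 *> (r : R))].
have [n|n r [m [Sm Am]]|n2 h2] := art I.
- split.
  + by exists 0; split; [exact: submod0|rewrite add0r ract0r; apply: submod0].
  + move=> x y [m [Sm Am]] [m' [Sm' Am']]; exists (m + m').
    by split; [exact: submodD|rewrite ractDr addrACA; apply: submodD].
  + move=> x r [m [Sm Am]]; exists (m *> r); split; first exact: submodM.
    by rewrite ractA -ractDl; apply: submodM.
- by exists m; split=> //; apply: decA.
exists (maxn n1 n2) => m; rewrite geq_max => /andP[nm1 nm2] x [Ax Sx].
have [y [r [Sy ex]]] := SS j jk x Sx.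
have [|y' [Sy' Ay']] := h2 m nm2 r.
  by exists y; rewrite -/g0 -ex; split=> //; apply: homA Ax; rewrite leq_maxr.
have d : x - (y' + g0 *> r) = y - y' by rewrite ex opprD addrACA subrr addr0.
apply: (submodBr (sA m) _ Ay'); rewrite d; apply: (h1 m nm1); split; last exact: submodB.
rewrite -d; apply: submodB => //; first by apply: homA Ax; rewrite leq_maxl.
exact: homA Ay'.
Qed.

End FgArtinian.

(** * The Hopkins-Levitzki theorem *)

Section Hopkins.
Variable R : pzRingType.
Notation Rr := (regr R).

Definition max_right_ideal (m : set Rr) : Prop :=
  [/\ submod m, ~ m 1 & forall x : R, ~ m x -> exists c : R, m (1 - x * c)].

Definition jacobson : set Rr := [set r | forall m, max_right_ideal m -> m r].

(** y generates a simple or zero submodule modulo N. *)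
Definition simple_mod (M : rightModType R) (N : set M) (y : M) : Prop :=
  forall b, ~ N (y *> b) -> exists c, N (y - y *> b *> c).

Lemma submod_mulr (A : set Rr) (x y : R) : submod A -> A x -> A (x * y).
Proof. by move=> sA Ax; exact: (@submodM R Rr A x y sA Ax). Qed.

Lemma submod_zero (A : set Rr) : submod A -> A (0 : R).
Proof. by case. Qed.

Lemma submod_add (A : set Rr) (x y : R) : submod A -> A x -> A y -> A (x + y).
Proof. by case=> _ h _; exact: h. Qed.

Lemma submod_sub (A : set Rr) (x y : R) : submod A -> A x -> A y -> A (x - y).
Proof. exact: submodB. Qed.

Lemma jacobsonMl (r s : R) : jacobson r -> jacobson (s * r).
Proof.
move=> Jr m mm; case: (mm) => sm m1 mx.
have [ms|nms] := pselect (m s); first exact: submod_mulr.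
apply: (Jr [set x : Rr | m (s * x)]); split.
- split; first by rewrite /= mulr0; apply: submod_zero.
    by move=> x y mX mY; rewrite /= mulrDr; apply: submod_add.
  by move=> x t mX; rewrite /= mulrA; exact: submod_mulr.
- by rewrite /= mulr1.
- move=> x /= /mx [c hc]; exists (c * s).
  by rewrite mulrBr mulr1 !mulrA -[X in X - _]mul1r -mulrBl; apply: submod_mulr.
Qed.

(** Modulo a suitable right ideal contained in the Jacobson radical, the ring is
    generated by elements generating simple submodules. The descending chain
    condition gives a minimal K with this property. It lies in every maximal
    right ideal m: otherwise 1 = u + (1 - u) with u in K and 1 - u in m, and
    multiplication by 1 - u turns generators for K into generators for the
    intersection of K and m. *)
Lemma semisimple_quotient : artinian Rr ->
  exists K : set Rr, [/\ submod K, K `<=` jacobson &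
    forall D : set Rr, submod D -> K `<=` D ->
      (forall y, simple_mod K y -> D y) -> D 1].
Proof.
move=> art; pose P (K : set Rr) := forall D : set Rr, submod D -> K `<=` D ->
      (forall y, simple_mod K y -> D y) -> D 1.
have [|K [sK PK minK]] := artinian_min (P := P) art.
  by exists setT; split=> // D _ TD _; apply: TD.
exists K; split=> // k Kk m mm; apply: contrapT => nmk.
case: (mm) => sm m1 mx; have [c mc] := mx _ nmk.
have [u [Ku mu]] : exists u : R, K u /\ m (1 - u).
  by exists ((k : R) * c); split; [exact: submod_mulr|].
suff PI : P (K `&` m).
  have KI := minK _ (submodI sK sm) PI.
  by have [|_ /nmk] := KI _ k Kk; first by move=> ? [].
move=> D sD ID SD.
pose D' := [set r : Rr | D ((1 - u) * r)].
have mul := submod_mulr.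
have D'1 : D' 1.
  apply: PK.
  - split; first by rewrite /D' /= mulr0; apply: submod_zero.
      by move=> x y; rewrite /D' /= mulrDr; apply: submod_add.
    by move=> x t; rewrite /D' /= => Dx; rewrite mulrA; apply: mul.
  - move=> x Kx; apply: ID; split; last exact: mul.
    by rewrite mulrBl mul1r; apply: submod_sub => //; apply: mul.
  - move=> y sy; apply: SD => b; rewrite /ract /= => nb.
    have mb z : m ((1 - u) * z) by apply: mul.
    have [|e Ke] := sy b.
      move=> Kyb; apply: nb; split; last first.
        by rewrite -[_ *: _]/((1 - u) * y * b) -mulrA.
      rewrite -[_ *: _]/((1 - u) * y * b) -mulrA mulrBl mul1r.
      by apply: submod_sub => //; apply: mul.
    have E : ((1 - u) * y - (1 - u) * y * b * e) = (1 - u) * ((y : R) - (y : R) * b * e).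
      by rewrite mulrBr !mulrA.
    exists e; rewrite -[X in _ - X]/((1 - u) * y * b * e) E; split => //.
    by rewrite mulrBl mul1r; apply: submod_sub => //; apply: mul.
have Du : D u.
  apply: SD => b; rewrite /ract /= => nb.
  have [|e me] := mx (u * b).
    by move=> mub; apply: nb; split => //; apply: mul.
  exists (e * u); change ((K `&` m) (u - u * b * (e * u))); rewrite !mulrA.
  split; first by apply: submod_sub => //; rewrite -!mulrA; exact: submod_mulr.
  have -> : u - u * b * e * u = (1 - u * b * e) * u by rewrite mulrBl mul1r.
  exact: mul.
have : D ((1 - u) + u) by apply: submod_add => //; rewrite -[1 - u]mulr1.
by rewrite subrK.
Qed.

Section MinimalCounterexample.
Variables (M : rightModType R) (T : set M).
Hypothesis artR : artinian Rr.
Hypothesis sT : submod T.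
Hypothesis nfgT : ~ fgsub T.
Hypothesis fgT : forall B, submod B -> B `<=` T -> ~ (T `<=` B) -> fgsub B.

Lemma fgsub_addcyc (A : set M) x : submod A -> fgsub A -> fgsub (addcyc A x).
Proof.
move=> sA [s [sA' hs]]; exists (x :: s); split.
  move=> y; rewrite inE => /orP[/eqP->|/sA' Ay]; first exact: addcyc_gen.
  exact: sub_addcyc.
move=> B sB sB'; apply: addcyc_min => //; last by apply: sB'; apply: mem_head.
by apply: hs => // y ys; apply: sB'; rewrite inE ys orbT.
Qed.

(** T/N is generated by elements generating simple submodules. If it were
    nonzero, a submodule C maximal for avoiding some x in T would satisfy
    T = C + xR; but then T would be finitely generated. *)
Lemma top_zero (N : set M) : submod N -> N `<=` T ->
  (forall z j, T z -> jacobson j -> N (z *> j)) -> T `<=` N.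
Proof.
move=> sN NT hN x Tx; apply: contrapT => nNx.
pose P : set (set M) := [set C | C = set0 \/ [/\ submod C, N `<=` C, C `<=` T & ~ C x]].
have [C [PC maxC]] : exists A, P A /\ forall B, A `<` B -> ~ P B.
  apply: Zorn_bigcup => F FP totF.
  have [[C0 [FC0 [y0 C0y0]]]|noC] := pselect (exists C, F C /\ C !=set0); last first.
    left; apply/seteqP; split=> // y [C FC Cy]; case: noC; exists C; split=> //.
    by exists y.
  have good C y : F C -> C y -> [/\ submod C, N `<=` C, C `<=` T & ~ C x].
    by move=> FC Cy; case: (FP _ FC) => // CE; move: Cy; rewrite CE.
  have [sC0 NC0 C0T nC0x] := good _ _ FC0 C0y0.
  right; split.
  - split; first by exists C0 => //; apply: submod0.
    + move=> a b [A FA Aa] [B FB Bb].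
      have [sA _ _ _] := good _ _ FA Aa; have [sB _ _ _] := good _ _ FB Bb.
      by case: (totF _ _ FA FB) => h; [exists B|exists A] => //;
        apply: submodD => //; apply: h.
    + move=> a r [A FA Aa]; have [sA _ _ _] := good _ _ FA Aa.
      by exists A => //; apply: submodM.
  - by move=> y Ny; exists C0 => //; apply: NC0.
  - by move=> y [A FA Ay]; have [_ _ AT _] := good _ _ FA Ay; apply: AT.
  - by move=> [A FA Ax]; have [] := good _ _ FA Ax.
have {PC} [sC NC CT nCx] : [/\ submod C, N `<=` C, C `<=` T & ~ C x].
  case: PC => // C0; exfalso; apply: (maxC N); last by right; split.
  by rewrite C0; split => // /(_ _ (submod0 sN)).
have [K [sK KJ genK]] := semisimple_quotient artR.
have sD := submod_addcyc x sC.
apply: nfgT; have -> : T = addcyc C x.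
  apply/seteqP; split; last exact: addcyc_min.
  move=> z Tz.
  suff : addcyc C x (z *> 1) by rewrite ract1.
  apply: (genK [set r : Rr | addcyc C x (z *> (r : R))]).
  - split; first by rewrite /= ract0r; apply: submod0.
      by move=> a b; rewrite /= ractDr; apply: submodD.
    move=> a t /= Da; rewrite -[_ *> _]/(z *> ((a : R) * t)) ractA.
    exact: submodM.
  - by move=> r Kr; apply: sub_addcyc; apply: NC; apply: hN => //; apply: KJ.
  move=> y sy; apply: contrapT => nDy.
  have Cx : addcyc C (z *> y) x.
    apply: contrapT => nx; apply: (maxC (addcyc C (z *> y))); last first.
      right; split=> //; first exact: submod_addcyc.
        by move=> v Nv; apply: sub_addcyc; apply: NC.
      by apply: addcyc_min => //; apply: submodM.
    split; first exact: sub_addcyc.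
    by move=> E; apply: nDy; apply: sub_addcyc; apply: E; exact: addcyc_gen.
  case: Cx => c [b [Cc ex]].
  have nKyb : ~ K ((y : R) * b).
    move=> Kyb; apply: nCx; rewrite ex; apply: submodD => //; apply: NC.
    by rewrite -ractA; apply: hN => //; apply: KJ.
  have [e Ke] := sy b nKyb.
  apply: nDy; apply: (submodBr sD (y := z *> y *> b *> e)).
    apply: sub_addcyc; apply: NC; rewrite -!ractA -ractBr; apply: hN => //.
    by rewrite mulrA; apply: KJ.
  apply: submodM => //; have -> : z *> y *> b = x - c by rewrite ex addrC addKr.
  by apply: submodB => //; [apply: addcyc_gen|apply: sub_addcyc].
apply: fgsub_addcyc => //; apply: fgT => // TC; exact/nCx/TC.
Qed.

End MinimalCounterexample.

(** The Hopkins-Levitzki theorem. Let T be a minimal submodule that is not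
    finitely generated and J the Jacobson radical; then T = TJ. Let B be a
    minimal two-sided ideal with T = TB, and I a minimal right ideal with
    IB <> 0. The elements of I killed by B form the largest proper submodule L
    of I, so I/L is simple and IJ is contained in L, whence IJB = 0. As
    T = TJ, the ideal of the b in B with Ib = 0 has the defining property of B;
    so it is B, and IB = 0. *)
Lemma artinian_fgsub (M : rightModType R) : artinian Rr -> artinian M ->
  forall A : set M, submod A -> fgsub A.
Proof.
move=> artR artM A sA; apply: contrapT => nfgA.
have [|T [sT nfgT minT]] := artinian_min (P := fun A => ~ fgsub A) artM.
  by exists A.
have fgT (B : set M) : submod B -> B `<=` T -> ~ (T `<=` B) -> fgsub B.
  by move=> sB BT nTB; apply: contrapT => nfgB; apply: nTB; apply: minT.
have top N sN := @top_zero M T artR sT nfgT fgT N sN.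
have topI N : submod N -> (forall z j, T z -> jacobson j -> N (z *> j)) -> T `<=` N.
  move=> sN hN; suff TN : T `<=` T `&` N by move=> z /TN [].
  apply: top => [||z j Tz Jj]; first exact: submodI.
    by move=> ? [].
  by split; [apply: submodM|apply: hN].
pose two (B : set Rr) := forall (r b : R), B b -> B (r * b).
pose gen (B : set Rr) := forall N, submod N ->
  (forall z b, T z -> B b -> N (z *> b)) -> T `<=` N.
have [|B [sB [twoB genB] minB]] := artinian_min (P := fun B => two B /\ gen B) artR.
  exists setT; split=> //; split=> // N sN hN z Tz.
  by rewrite -[z]ract1; apply: hN.
have mul := submod_mulr.
have nz : exists b : R, B b /\ b <> 0.
  apply: contrapT => B0; apply: nfgT; exists [::]; split=> // N sN _.
  apply: genB => // z b Tz Bb; have -> : b = 0.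
    by apply: contrapT => b0; apply: B0; exists b.
  by rewrite ract0r; apply: submod0.
have [|I [sI [x0 [b0 [Ix0 Bb0 xb0]]] minI]] :=
    artinian_min (P := fun I : set Rr => exists (x b : R), [/\ I x, B b & x * b <> 0]) artR.
  by have [b [Bb b0]] := nz; exists setT; split=> //; exists 1, b; rewrite mul1r.
pose L := [set x : Rr | I x /\ forall b : R, B b -> (x : R) * b = 0].
have IJL (x j : R) : I x -> jacobson j -> L (x * j).
  move=> Ix Jj.
  pose m := [set r : Rr | L (x0 * (r : R))].
  have sL : submod L.
    split; first by split; [exact: submod0|move=> b _; rewrite mul0r].
      move=> a b [Ia ha] [Ib hb]; split; first exact: submodD.
      by move=> c Bc; rewrite mulrDl ha // hb // addr0.
    move=> a r [Ia ha]; split; first exact: submodM.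
    move=> b Bb; rewrite -[_ *> _]/((a : R) * r) -mulrA; apply: ha.
    exact: twoB.
  have big (y : R) : I y -> ~ L y -> forall x, I x -> exists r : R, x = y * r.
    move=> Iy nLy.
    pose yR := [set v : Rr | exists r : R, v = y * r].
    have syR : submod yR.
      split; first by exists 0; rewrite mulr0.
        by move=> _ _ [r ->] [s ->]; exists (r + s); rewrite mulrDr.
      by move=> _ t [r ->]; exists (r * t); rewrite mulrA.
    apply: (minI yR) => //; last by move=> _ [r ->]; apply: mul.
    have [b [Bb yb]] : exists b : R, B b /\ y * b <> 0.
      apply: contrapT => H; apply: nLy; split=> // b Bb.
      by apply: contrapT => yb; apply: H; exists b.
    by exists y, b; split=> //; exists 1; rewrite mulr1.
  have nLx0 : ~ L x0 by move=> [_ /(_ _ Bb0)].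
  have mm : max_right_ideal m.
    split.
    - split; first by rewrite /m /= mulr0; apply: submod_zero.
        by move=> a b; rewrite /m /= mulrDr; apply: submod_add.
      by move=> a t; rewrite /m /= mulrA => La; apply: mul.
    - by rewrite /m /= mulr1.
    - rewrite /m /= => r nLr; have [c e] := big (x0 * r) (mul _ _ r sI Ix0) nLr x0 Ix0.
      by exists c; rewrite mulrBr mulr1 mulrA -e subrr; apply: submod_zero.
  have [r ->] := big x0 Ix0 nLx0 x Ix.
  by rewrite -mulrA; apply: jacobsonMl Jj _ mm.
pose B' := [set b : Rr | B b /\ forall x : R, I x -> x * (b : R) = 0].
have B'B : B `<=` B'.
  apply: minB; last by move=> ? [].
  - split; first by split; [exact: submod0|move=> x _; rewrite mulr0].
      move=> a b [Ba ha] [Bb hb]; split; first exact: submodD.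
      by move=> x Ix; rewrite mulrDr ha // hb // addr0.
    move=> a r [Ba ha]; split; first exact: submodM.
    by move=> x Ix; rewrite -[_ *> _]/((a : R) * r) mulrA ha // mul0r.
  split.
    move=> r b [Bb hb]; split; first exact: twoB.
    by move=> x Ix; rewrite mulrA hb //; apply: mul.
  move=> N sN hN.
  suff TN2 : T `<=` [set z | forall b : R, B b -> N (z *> b)].
    by apply: genB => // z b /TN2; apply.
  apply: topI => [|z j Tz Jj b Bb].
    split; first by move=> b _; rewrite ract0l; apply: submod0.
      by move=> u v hu hv b Bb; rewrite ractDl; apply: submodD; [|apply: hu|apply: hv].
    by move=> u r hu b Bb; rewrite -ractA; apply: hu; apply: twoB.
  rewrite -ractA; apply: hN => //; split; first exact: twoB.
  by move=> x Ix; rewrite mulrA; have [_ ->] := IJL x j Ix Jj.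
by have [_ /(_ _ Ix0)] := B'B _ Bb0.
Qed.

Lemma fg_noetherian (M : rightModType R) :
  right_artinian R -> finitely_generated M -> noetherian M.
Proof.
move=> artR fgM; apply: noetherian_of_fgsub; apply: artinian_fgsub.
  exact: regr_artinian.
exact: fg_artinian.
Qed.

End Hopkins.

(** * Gradings as families of projections *)

Definition win (b : nat) : seq int := [seq i%:Z - b%:Z | i <- iota 0 (b.*2.+1)].

Lemma mem_win b n : (n \in win b) = (`|n| <= b)%N.
Proof.
apply/mapP/idP => [[i]|h]; first by rewrite mem_iota => /andP[_ hi] ->; lia.
exists (absz (n + b%:Z)); last by lia.
by rewrite mem_iota; lia.
Qed.

Lemma uniq_win b : uniq (win b).
Proof. by rewrite map_inj_uniq ?iota_uniq // => i j; lia. Qed.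

Section Sums.
Variable V : zmodType.
Implicit Types F : int -> V.

Lemma sum_supp F (s s' : seq int) : uniq s -> uniq s' ->
  (forall k, F k <> 0 -> k \in s) -> (forall k, F k <> 0 -> k \in s') ->
  \sum_(k <- s) F k = \sum_(k <- s') F k.
Proof.
move=> us us' h h'.
have red (t : seq int) : \sum_(k <- t) F k = \sum_(k <- [seq k <- t | F k != 0]) F k.
  rewrite big_filter (bigID (fun k => F k == 0)) /= big1 ?add0r //.
  by move=> k /eqP.
rewrite red [RHS]red; apply: perm_big; apply: uniq_perm; rewrite ?filter_uniq //.
move=> k; rewrite !mem_filter; case: eqP => //= Fk.
by rewrite h ?h'.
Qed.

Lemma sum_win_widen F b b' : (b <= b')%N -> (forall k, F k <> 0 -> (`|k| <= b)%N) ->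
  \sum_(k <- win b') F k = \sum_(k <- win b) F k.
Proof.
move=> bb' h; apply: sum_supp; rewrite ?uniq_win // => k /h; rewrite mem_win //.
by move=> kb; apply: leq_trans bb'.
Qed.

Lemma sum_win_shift F b (i : int) :
  (forall k, F k <> 0 -> (`|k| <= b)%N) -> (forall k, F k <> 0 -> (`|k - i| <= b)%N) ->
  \sum_(k <- win b) F (k + i) = \sum_(k <- win b) F k.
Proof.
move=> h h'; rewrite -(big_map (fun k => k + i) xpredT F); apply: sum_supp.
- by rewrite map_inj_uniq ?uniq_win //; apply: addIr.
- exact: uniq_win.
- move=> k /h' hk; apply/mapP; exists (k - i); last by rewrite subrK.
  by rewrite mem_win.
- by move=> k /h; rewrite mem_win.
Qed.

Lemma sum_win1 F b (i : int) : (`|i| <= b)%N -> (forall k, k != i -> F k = 0) ->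
  \sum_(k <- win b) F k = F i.
Proof.
move=> ib h; rewrite (bigD1_seq i) ?mem_win ?uniq_win //= big1 ?addr0 //.
Qed.

End Sums.

Definition additivef (U V : zmodType) (f : U -> V) := forall x y, f (x + y) = f x + f y.

Section Addf.
Variables (U V : zmodType) (f : U -> V).
Hypothesis af : additivef f.
Lemma addf0 : f 0 = 0.
Proof. by apply: (@addrI _ (f 0)); rewrite -af !addr0. Qed.
Lemma addfN x : f (- x) = - f x.
Proof. by apply: (@addrI _ (f x)); rewrite -af !subrr addf0. Qed.
Lemma addfB x y : f (x - y) = f x - f y.
Proof. by rewrite af addfN. Qed.
Lemma addf_sum I (s : seq I) (P : pred I) F :
  f (\sum_(i <- s | P i) F i) = \sum_(i <- s | P i) f (F i).
Proof. by elim/big_rec2: _ => [|i y x _ <-]; rewrite ?addf0. Qed.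
End Addf.

(** With the projections onto the components, the graded maps are those that
    commute with all of them. *)
Definition grading (V : zmodType) (p : int -> V -> V) : Prop :=
  [/\ forall n, additivef (p n),
      forall m n v, p m (p n v) = if m == n then p n v else 0
    & forall v, exists b, v = \sum_(n <- win b) p n v].

Section Grading.
Variables (V : zmodType) (p : int -> V -> V).
Hypothesis gp : grading p.

Lemma gr_add n : additivef (p n). Proof. by case: gp. Qed.
Lemma gr_id n v : p n (p n v) = p n v. Proof. by case: gp => _ -> _; rewrite eqxx. Qed.
Lemma gr_orth m n v : m != n -> p m (p n v) = 0.
Proof. by case: gp => _ -> _ /negPf ->. Qed.
Lemma gr_proj m n v : p m (p n v) = if m == n then p n v else 0.
Proof. by case: gp. Qed.
Lemma gr0 n : p n 0 = 0. Proof. exact/addf0/gr_add. Qed.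
Lemma grB n x y : p n (x - y) = p n x - p n y. Proof. exact/addfB/gr_add. Qed.
Lemma gr_fin v : exists b, forall n, p n v <> 0 -> (`|n| <= b)%N.
Proof.
have [b hb] : exists b, v = \sum_(n <- win b) p n v by case: gp.
exists b => n; rewrite -mem_win => nz; apply/negPn/negP => nb; apply: nz.
rewrite {1}hb (addf_sum (gr_add n)) big_seq big1 // => m mb.
by rewrite gr_orth //; apply: contraNneq nb => ->.
Qed.
Lemma gr_sum v b : (forall n, p n v <> 0 -> (`|n| <= b)%N) -> v = \sum_(n <- win b) p n v.
Proof.
move=> hb; have [b' hb'] : exists b, v = \sum_(n <- win b) p n v by case: gp.
have [c hc] := gr_fin v.
rewrite {1}hb'; pose d := maxn (maxn b b') c.
transitivity (\sum_(n <- win d) p n v); last by apply: sum_win_widen => //; rewrite /d; lia.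
apply: sum_supp; rewrite ?uniq_win // => n nz; rewrite mem_win; last first.
  by have := hc n nz; rewrite /d; lia.
apply/negPn/negP; rewrite -mem_win => nb; apply: nz.
rewrite hb' (addf_sum (gr_add n)) big_seq big1 // => m mb.
by rewrite gr_orth //; apply: contraNneq nb => ->.
Qed.
Lemma gr_eq x y : (forall n, p n x = p n y) -> x = y.
Proof.
move=> h; have [b hb] := gr_fin x; rewrite (gr_sum hb) [RHS](@gr_sum _ b).
  by apply: eq_bigr => n _.
by move=> n; rewrite -h; apply: hb.
Qed.

Definition supp_bound (b : nat) := forall n v, p n v <> 0 -> (`|n| <= b)%N.

Lemma fsfun_sumE (c : {fsfun int -> V with 0}) b :
  (forall n, c n <> 0 -> (`|n| <= b)%N) -> fsfun_sum c = \sum_(n <- win b) c n.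
Proof.
move=> hb; apply: sum_supp; rewrite ?uniq_win ?fset_uniq // => k.
  by move/eqP; rewrite mem_finsupp.
by move/hb; rewrite mem_win.
Qed.

Lemma fsfun_fin (c : {fsfun int -> V with 0}) :
  exists b, forall n, c n <> 0 -> (`|n| <= b)%N.
Proof.
exists (\max_(n <- finsupp c) `|n|%N) => n /eqP cn.
have : n \in enum_fset (finsupp c) by rewrite mem_finsupp.
by move/(@leq_bigmax_seq _ _ xpredT absz); apply.
Qed.

Lemma grading_direct_sum : direct_sum (fun n => [pred v | p n v == v]).
Proof.
split=> [n|v].
  split; rewrite ?inE ?gr0 // => x y; rewrite !inE => /eqP px /eqP py.
  by rewrite grB px py.
have [b hb] := gr_fin v.
pose c : {fsfun int -> V with 0} := [fsfun n in seq_fset tt (win b) => p n v | 0].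
have cE n : c n = p n v.
  rewrite fsfun_fun seq_fsetE mem_win; case: ifPn => // nb.
  by apply/esym/eqP; apply: contraNT nb => /eqP/hb.
exists c; split.
  split=> [n|]; first by rewrite inE cE gr_id.
  rewrite (@fsfun_sumE c b) => [|n]; last by rewrite cE; apply: hb.
  by under eq_bigr => n _ do rewrite cE; apply: gr_sum.
move=> c' [hc' ev]; apply/fsfunP => n; rewrite cE ev.
have [b' hb'] := fsfun_fin c'.
rewrite (fsfun_sumE hb') (addf_sum (gr_add n)).
have pc m : p n (c' m) = if n == m then c' n else 0.
  have := hc' m; rewrite inE => /eqP e; case: eqP => [->//|/eqP nm].
  by rewrite -e gr_orth.
have [nb|nb] := boolP (`|n| <= b')%N.
  rewrite (sum_win1 nb) ?pc ?eqxx // => k kn; by rewrite pc eq_sym (negPf kn).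
rewrite big_seq big1 => [|m]; last first.
  by rewrite mem_win pc; case: eqP nb => [->/negPf->|].
by apply/esym; apply: contrapT => /hb'; apply/negP.
Qed.

End Grading.

Lemma direct_sum_grading (V : zmodType) (A : int -> {pred V}) : direct_sum A ->
  exists p, grading p /\ forall n v, v \in A n <-> p n v = v.
Proof.
move=> [zA dA].
have zA0 n : 0 \in A n by case: (zA n).
have ZB n x y : x \in A n -> y \in A n -> x - y \in A n.
  by case: (zA n) => _; apply.
have ZD n x y : x \in A n -> y \in A n -> x + y \in A n.
  by move=> xA yA; rewrite -[y]opprK -[- y]sub0r; apply: (ZB) => //; apply: ZB.
have [c hc] : {c : V -> {fsfun int -> V with 0} | forall v,
    ((forall n, c v n \in A n) /\ v = fsfun_sum (c v)) /\
    forall c' : {fsfun int -> V with 0}, (forall n, c' n \in A n) /\ v = fsfun_sum c' -> c v = c'}.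
  apply: (@cid (V -> {fsfun int -> V with 0})).
  by have [c hc] := choice dA; exists c => v; apply: hc.
(* The unique decomposition of v, for families F that are plain functions. *)
have uni v (F : int -> V) b : (forall n, F n \in A n) -> (forall n, F n <> 0 -> (`|n| <= b)%N) ->
    v = \sum_(n <- win b) F n -> forall n, c v n = F n.
  move=> FA Fb ev n.
  pose c' : {fsfun int -> V with 0} := [fsfun n in seq_fset tt (win b) => F n | 0].
  have cE m : c' m = F m.
    rewrite fsfun_fun seq_fsetE mem_win; case: ifPn => // mb.
    by apply/esym/eqP; apply: contraNT mb => /eqP/Fb.
  rewrite -cE; have [_ /(_ c') ->] // := hc v; split=> [m|]; first by rewrite cE.
  rewrite (@fsfun_sumE _ c' b) => [|m]; last by rewrite cE; apply: Fb.
  by under eq_bigr => m _ do rewrite cE.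
have cA v n : c v n \in A n by have [[]] := hc v.
have csum v b : (forall n, c v n <> 0 -> (`|n| <= b)%N) -> v = \sum_(n <- win b) c v n.
  by move=> hb; rewrite -(fsfun_sumE hb); have [[]] := hc v.
have chom n v : v \in A n -> forall m, c v m = if m == n then v else 0.
  move=> vA; apply: (@uni v _ `|n|%N) => [m|m|]; try by case: eqP => // ->.
  by rewrite (sum_win1 (leqnn _)) ?eqxx // => k /negPf->.
exists (fun n v => c v n); split; last first.
  by move=> n v; split=> [/chom ->|<-]; rewrite ?eqxx.
split.
- move=> n x y.
  have [b1 h1] := fsfun_fin (c x); have [b2 h2] := fsfun_fin (c y).
  have w1 k : c x k <> 0 -> (`|k| <= maxn b1 b2)%N by move=> /h1; lia.
  have w2 k : c y k <> 0 -> (`|k| <= maxn b1 b2)%N by move=> /h2; lia.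
  apply: (@uni (x + y) (fun n => c x n + c y n) (maxn b1 b2)) => [k|k|].
  + exact: ZD.
  + have [/eqP->|/eqP /w1 //] := boolP (c x k == 0).
    by rewrite add0r; apply: w2.
  + by rewrite big_split /= -csum // -csum.
- by move=> m n v; rewrite (chom n).
- move=> v; have [b hb] := fsfun_fin (c v); exists b; exact: csum.
Qed.

(** * Endomorphisms of modules of finite length *)

Definition rlin (R : pzRingType) (M N : rightModType R) (f : M -> N) : Prop :=
  additivef f /\ forall x r, f (x *> r) = f x *> r.

Section Rlin.
Variable R : pzRingType.
Implicit Types L M N : rightModType R.

Lemma rlin_add M N (f : M -> N) : rlin f -> additivef f. Proof. by case. Qed.
Lemma rlinM M N (f : M -> N) x r : rlin f -> f (x *> r) = f x *> r.
Proof. by case=> _; apply. Qed.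
Lemma rlinD M N (f : M -> N) x y : rlin f -> f (x + y) = f x + f y.
Proof. by case=> h _; apply: h. Qed.
Lemma rlinB M N (f : M -> N) x y : rlin f -> f (x - y) = f x - f y.
Proof. by case=> h _; rewrite addfB. Qed.
Lemma rlin0 M N (f : M -> N) : rlin f -> f 0 = 0.
Proof. by case=> h _; rewrite addf0. Qed.
Lemma rlin_sum M N (f : M -> N) I (s : seq I) (P : pred I) F : rlin f ->
  f (\sum_(i <- s | P i) F i) = \sum_(i <- s | P i) f (F i).
Proof. by case=> h _; rewrite addf_sum. Qed.
Lemma rlin_id M : rlin (@id M). Proof. by []. Qed.
Lemma rlin_comp L M N (g : M -> N) (f : L -> M) : rlin g -> rlin f -> rlin (g \o f).
Proof.
by move=> [ag lg] [af lf]; split=> [x y|x r]; rewrite /= ?af ?ag ?lf ?lg.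
Qed.
Lemma rlin_addf M N (f g : M -> N) : rlin f -> rlin g -> rlin (fun v => f v + g v).
Proof.
move=> [af lf] [ag lg]; split=> [x y|x r]; first by rewrite af ag addrACA.
by rewrite lf lg ractDl.
Qed.
Lemma rlin_sub M N (f g : M -> N) : rlin f -> rlin g -> rlin (fun v => f v - g v).
Proof.
move=> [af lf] [ag lg]; split=> [x y|x r]; first by rewrite af ag opprD addrACA.
by rewrite lf lg ractBl.
Qed.
Lemma rlin_sumf M N (I : Type) (s : seq I) (F : I -> M -> N) : (forall i, rlin (F i)) ->
  rlin (fun v => \sum_(i <- s) F i v).
Proof.
move=> lF; split=> [x y|x r].
  by rewrite -big_split; apply: eq_bigr => i _; apply: rlinD.
by rewrite ract_suml; apply: eq_bigr => i _; apply: rlinM.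
Qed.
Lemma rlin_inv M N (f : M -> N) g : rlin f -> cancel f g -> cancel g f -> rlin g.
Proof.
move=> lf fg gf; split=> [x y|x r].
  by rewrite -{1}[x]gf -{1}[y]gf -rlinD // fg.
by rewrite -{1}[x]gf -rlinM // fg.
Qed.
Lemma rlin_iter M (f : M -> M) n : rlin f -> rlin (iter n f).
Proof.
move=> lf; elim: n => [|n IH]; first exact: rlin_id.
by split=> [x y|x r]; rewrite !iterS; [rewrite (rlinD _ _ IH) rlinD|rewrite (rlinM _ _ IH) rlinM].
Qed.
Lemma submod_ker M N (f : M -> N) : rlin f -> submod [set v | f v = 0].
Proof.
move=> lf; split; first exact: rlin0.
  by move=> x y /= fx fy; rewrite rlinD // fx fy addr0.
by move=> x r /= fx; rewrite rlinM // fx ract0l.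
Qed.
Lemma submod_range M N (f : M -> N) : rlin f -> submod (range f).
Proof.
move=> lf; split; first by exists 0 => //; apply: rlin0.
  by move=> _ _ [x _ <-] [y _ <-]; exists (x + y) => //; apply: rlinD.
by move=> _ r [x _ <-]; exists (x *> r) => //; apply: rlinM.
Qed.
Lemma rlin_inj M N (f : M -> N) : rlin f -> (forall v, f v = 0 -> v = 0) -> injective f.
Proof.
by move=> lf h x y fxy; apply/eqP; rewrite -subr_eq0; apply/eqP/h; rewrite rlinB // fxy subrr.
Qed.
End Rlin.

Lemma inj_surj_bij (A B : Type) (f : A -> B) :
  injective f -> (forall y, exists x, f x = y) -> bijective f.
Proof.
move=> fi /choice [g gf]; exists g => // x; apply: fi; exact: gf.
Qed.

(** The maps commuting with a family p of additive maps are treated uniformly: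
    when p consists of the projections of a grading they are the graded maps;
    when every p n is the identity they are all maps. *)
Definition commutes (R : pzRingType) (M : rightModType R) (p : int -> M -> M) (f : M -> M) :=
  forall n v, f (p n v) = p n (f v).

Definition stable_under (R : pzRingType) (M : rightModType R) (p : int -> M -> M) (A : set M) :=
  forall n v, A v -> A (p n v).

Definition indec (R : pzRingType) (M : rightModType R) (p : int -> M -> M) (A : set M) : Prop :=
  (exists2 v, A v & v != 0) /\
  forall B C : set M, submod B -> submod C -> stable_under p B -> stable_under p C ->
    B `<=` A -> C `<=` A ->
    (forall v, A v -> exists b c, [/\ B b, C c & v = b + c]) ->
    (forall v, B v -> C v -> v = 0) ->
    (forall v, B v -> v = 0) \/ (forall v, C v -> v = 0).

Section Fitting.
Variables (R : pzRingType) (M : rightModType R) (p : int -> M -> M).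
Hypothesis artM : artinian M.
Hypothesis noeM : noetherian M.
Hypothesis p_add : forall n, additivef (p n).
Hypothesis indM : indec p [set: M].

(** For n large, M is the direct sum of the image and the kernel of f^n; both are
    stable under p, so one of them vanishes. *)
Lemma fitting (f : M -> M) : rlin f -> commutes p f ->
  (exists n, forall v, iter n f v = 0) \/ bijective f.
Proof.
move=> lf cf.
have li n : rlin (iter n f) by apply: rlin_iter.
have ci n : commutes p (iter n f).
  by elim: n => // n IH k v; rewrite !iterS IH cf.
have [n1 h1] : exists n, forall m, (n <= m)%N -> range (iter n f) `<=` range (iter m f).
  apply: artM => n; first exact: submod_range.
  by move=> _ [v _ <-]; exists (f v) => //; rewrite -iterSr.
have [n2 h2] : exists n, forall m, [set v | iter m f v = 0] `<=` [set v | iter n f v = 0].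
  apply: noeM => n; first exact: submod_ker.
  by move=> v /= h; rewrite h rlin0.
have [n [le1 le2 n_gt0]] : exists n, [/\ (n1 <= n)%N, (n2 <= n)%N & (0 < n)%N].
  by exists (maxn n1 n2).+1; split; lia.
have hk v : iter n f (iter n f v) = 0 -> iter n f v = 0.
  rewrite -iterD => /(h2 _ v) /= h.
  have -> : n = ((n - n2) + n2)%N by rewrite subnK.
  by rewrite iterD h rlin0.
have hr v : exists w, iter n f v = iter n f (iter n f w).
  have hn : (n1 <= n + n)%N by lia.
  have [|w _ e] := h1 _ hn (iter n f v).
    exists (iter (n - n1) f v) => //; rewrite -iterD; congr (iter _ f v).
    lia.
  by exists w; rewrite -iterD.
have [_ ind] := indM.
have [||||||||h|h] := ind (range (iter n f)) [set v | iter n f v = 0] => //.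
- exact: submod_range.
- exact: submod_ker.
- by move=> k _ [v _ <-]; exists (p k v); rewrite ?ci.
- by move=> k v /= h; rewrite ci h addf0.
- move=> v _; have [w e] := hr v.
  exists (iter n f w), (v - iter n f w); split; first by exists w.
    by rewrite /= rlinB // e subrr.
  by rewrite addrC subrK.
- by move=> _ [v _ <-] /=; apply: hk.
- by left; exists n => v; apply: h; exists v.
right; apply: inj_surj_bij.
  apply: rlin_inj => // v fv; apply: h; by rewrite /= -(prednK n_gt0) iterSr fv; apply: rlin0.
move=> y; have [w e] := hr y.
exists (iter n.-1 f w); rewrite -iterS; apply/eqP; rewrite -subr_eq0; apply/eqP.
by apply: h; rewrite /= rlinB // -iterS (prednK n_gt0) -e subrr.
Qed.

Lemma nilpotent_sub_bij (f : M -> M) : rlin f -> (exists n, forall v, iter n f v = 0) ->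
  bijective (fun v => v - f v).
Proof.
move=> lf [n hn]; apply: inj_surj_bij.
  apply: rlin_inj => [|v /eqP]; first by apply: rlin_sub.
  rewrite subr_eq0 => /eqP e; rewrite -(hn v).
  by elim: n {hn} => // n IH; rewrite iterSr -e.
move=> y; exists (\sum_(i < n) iter i f y).
rewrite (rlin_sum _ _ _ lf) -sumrB.
transitivity (y - iter n f y); last by rewrite hn subr0.
elim: n {hn} => [|n IH]; first by rewrite big_ord0 subrr.
by rewrite big_ord_recr /= IH addrA subrK.
Qed.

(** If u is the inverse of f + g, then u f is nilpotent or bijective by the
    Fitting lemma, and in the first case u g = 1 - u f is bijective. This is the
    locality of the endomorphism ring. *)
Lemma bij_add (f g : M -> M) : rlin f -> rlin g -> commutes p f -> commutes p g ->
  bijective (fun v => f v + g v) -> bijective f \/ bijective g.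
Proof.
move=> lf lg cf cg [u uK Ku].
have ls := rlin_addf lf lg.
have lu : rlin u := rlin_inv ls uK Ku.
have cu : commutes p u.
  by move=> n v; apply: (can_inj uK); rewrite Ku /= cf cg -p_add -[in LHS](Ku v).
have [||nil|bij] := @fitting (u \o f); first exact: rlin_comp.
- by move=> n v; rewrite /= cf cu.
- right.
  have [w wK Kw] := nilpotent_sub_bij (rlin_comp lu lf) nil.
  have e v : v - u (f v) = u (g v).
    by rewrite -{1}[v]uK rlinD // addrC addKr.
  exists (w \o u) => v; first by rewrite /= -e wK.
  apply: (can_inj Ku); rewrite /= -e; exact: Kw.
- left; apply: (eq_bij (f := (fun v => f v + g v) \o (u \o f))) => [|v].
    by apply: bij_comp => //; exists u.
  by rewrite /= Ku.
Qed.

Lemma bij_sum (I : eqType) (s : seq I) (F : I -> M -> M) :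
  (forall i, rlin (F i)) -> (forall i, commutes p (F i)) ->
  bijective (fun v => \sum_(i <- s) F i v) -> exists2 i, i \in s & bijective (F i).
Proof.
move=> lF cF; elim: s => [[g gK _]|i s IH hb].
  have [[v _ /eqP nv] _] := indM; case: nv.
  by rewrite -[v]gK big_nil -[RHS]gK big_nil.
have [|||||b|b] := @bij_add (F i) (fun v => \sum_(j <- s) F j v) => //.
- exact: rlin_sumf.
- move=> n v; rewrite (addf_sum (p_add n)); apply: eq_bigr => j _; exact: cF.
- by apply: (eq_bij hb) => v; rewrite big_cons.
- by exists i; rewrite ?mem_head.
- by have [j js bj] := IH b; exists j => //; rewrite inE js orbT.
Qed.

End Fitting.

(** * Idempotents *)

Section Idempotents.
Variables (R : pzRingType) (M : rightModType R) (p : int -> M -> M).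
Hypothesis artM : artinian M.
Hypothesis p_add : forall n, additivef (p n).

Definition idem (e : M -> M) := [/\ rlin e, commutes p e & forall v, e (e v) = e v].
Definition fixed (e : M -> M) : set M := [set v | e v = v].

Lemma submod_fixed e : idem e -> submod (fixed e).
Proof.
case=> le _ _; split; first exact: rlin0.
  by move=> x y ex ey; rewrite /fixed /= rlinD // ex ey.
by move=> x r ex; rewrite /fixed /= rlinM // ex.
Qed.

(** The projections of a direct sum decomposition of the image of e, composed
    with e. *)
Lemma dsum_idem (e : M -> M) (B C : set M) : idem e -> submod B -> submod C ->
  stable_under p B -> stable_under p C -> B `<=` fixed e -> C `<=` fixed e ->
  (forall v, fixed e v -> exists b c, [/\ B b, C c & v = b + c]) ->
  (forall v, B v -> C v -> v = 0) ->
  exists e1 e2, [/\ idem e1, idem e2,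
    [/\ forall v, e v = e1 v + e2 v, forall v, e1 (e2 v) = 0 & forall v, e2 (e1 v) = 0],
    forall v, B v -> e1 v = v & forall v, C v -> e2 v = v].
Proof.
move=> [le ce ee] sB sC pB pC Be Ce hs h0.
have /choice [f hf] v : exists bc : M * M, [/\ B bc.1, C bc.2 & e v = bc.1 + bc.2].
  by have [b [c ?]] := hs (e v) (ee v); exists (b, c).
have uni v b c : B b -> C c -> e v = b + c -> f v = (b, c).
  move=> Bb Cc ev; have [Bb' Cc' ev'] := hf v.
  have e' : (f v).1 - b = c - (f v).2.
    by apply/eqP; rewrite subr_eq addrAC eq_sym subr_eq -ev' addrC ev.
  have z : (f v).1 - b = 0.
    apply: h0; first exact: submodB.
    by rewrite e'; apply: submodB.
  move: e'; rewrite z; case: (f v) z => x y /= /eqP; rewrite subr_eq0 => /eqP-> /esym/eqP.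
  by rewrite subr_eq0 => /eqP->.
have fD x y : f (x + y) = ((f x).1 + (f y).1, (f x).2 + (f y).2).
  have [? ? ex] := hf x; have [? ? ey] := hf y.
  by apply: uni; [apply: submodD|apply: submodD|rewrite rlinD // ex ey addrACA].
have fM x r : f (x *> r) = ((f x).1 *> r, (f x).2 *> r).
  have [? ? ex] := hf x.
  by apply: uni; [apply: submodM|apply: submodM|rewrite rlinM // ex ractDl].
have fp n x : f (p n x) = (p n (f x).1, p n (f x).2).
  have [? ? ex] := hf x.
  by apply: uni; [apply: pB|apply: pC|rewrite ce ex p_add].
have fB b : B b -> f b = (b, 0).
  move=> Bb; apply: uni => //; first exact: submod0.
  by rewrite addr0; apply: Be.
have fC c : C c -> f c = (0, c).
  move=> Cc; apply: uni => //; first exact: submod0.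
  by rewrite add0r; apply: Ce.
exists (fun v => (f v).1), (fun v => (f v).2); split.
- split; [split=> [x y|x r]|move=> n v|move=> v]; rewrite ?fD ?fM ?fp // fB //.
  by case: (hf v).
- split; [split=> [x y|x r]|move=> n v|move=> v]; rewrite ?fD ?fM ?fp // fC //.
  by case: (hf v).
- split=> v; first by case: (hf v).
    by rewrite fC //; case: (hf v).
  by rewrite fB //; case: (hf v).
- by move=> v /fB->.
- by move=> v /fC->.
Qed.

(** The decomposition into indecomposable summands, phrased as an induction
    principle on idempotents so that no families of summands are handled. An
    idempotent of minimal image among the counterexamples would split. *)
Lemma idem_ind (P : (M -> M) -> Prop) :
  (forall e, idem e -> (forall v, e v = 0) -> P e) ->
  (forall e, idem e -> indec p (fixed e) -> P e) ->
  (forall e e1 e2, idem e -> idem e1 -> idem e2 -> (forall v, e v = e1 v + e2 v) ->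
     (forall v, e1 (e2 v) = 0) -> (forall v, e2 (e1 v) = 0) -> P e1 -> P e2 -> P e) ->
  forall e, idem e -> P e.
Proof.
move=> P0 Pi PD e0 ie0; apply: contrapT => nP0.
have [|A [_ [e [ie eA nPe]] minA]] := artinian_min
    (P := fun A => exists e, [/\ idem e, A = fixed e & ~ P e]) artM.
  by exists (fixed e0); split; [exact: submod_fixed|exists e0].
case: (ie) => le ce ee; subst A.
have [z|nz] := pselect (forall v, e v = 0); first exact/nPe/P0.
apply: (nPe); apply: (Pi) => //; split.
  apply: contrapT => H; apply: nz => v; apply/eqP/negPn/negP => ev; apply: H.
  by exists (e v).
move=> B C sB sC pB pC Be Ce hs h0; apply: contrapT => /not_orP [nB nC].
have [e1 [e2 [ie1 ie2 [eE e12 e21] eB eC]]] := dsum_idem ie sB sC pB pC Be Ce hs h0.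
have [[l1 _ e11] [l2 _ e22]] := (ie1, ie2).
apply: nPe; apply: (PD e e1 e2) => //.
- apply: contrapT => nP1; apply: nC => v Cv.
  have := minA _ (submod_fixed ie1) _ _ (e v) (ee v).
  rewrite /fixed /= (Ce v Cv) => h; rewrite -(eC v Cv) -(h _ _) ?e21 //.
    by exists e1.
  by move=> w e1w; rewrite /fixed /= eE e1w -{2}e1w e21 addr0.
- apply: contrapT => nP2; apply: nB => v Bv.
  have := minA _ (submod_fixed ie2) _ _ (e v) (ee v).
  rewrite /fixed /= (Be v Bv) => h; rewrite -(eB v Bv) -(h _ _) ?e12 //.
    by exists e2.
  by move=> w e2w; rewrite /fixed /= eE e2w -{1}e2w e12 add0r.
Qed.

End Idempotents.

(** * Graded modules *)

Definition ring_graded (R : pzRingType) (rho : int -> R -> R) : Prop :=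
  grading rho /\
  forall i j x y, rho (i + j) (rho i x * rho j y) = rho i x * rho j y.

Definition mod_graded (R : pzRingType) (rho : int -> R -> R) (M : rightModType R)
    (p : int -> M -> M) : Prop :=
  grading p /\
  forall i j v r, p (i + j) (p i v *> rho j r) = p i v *> rho j r.

Section GradedRing.
Variables (R : pzRingType) (rho : int -> R -> R).
Hypothesis hrho : ring_graded rho.
Let grho : grading rho := hrho.1.

Lemma rho_mul n i x r : rho n (rho i x * r) = rho i x * rho (n - i) r.
Proof.
have [b hb] := gr_fin grho r.
rewrite {1}(gr_sum grho hb) mulr_sumr (addf_sum (gr_add grho n)).
have e j : rho n (rho i x * rho j r) = if j == n - i then rho i x * rho (n - i) r else 0.
  rewrite -hrho.2 (gr_proj grho).
  case: (eqVneq j (n - i)) => [->|h]; last by rewrite ifF //; lia.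
  by rewrite ifT ?hrho.2 //; lia.
under eq_bigr => j _ do rewrite e.
have [nb|nb] := boolP (`|n - i| <= b)%N.
  by rewrite (sum_win1 nb) ?eqxx // => k /negPf->.
have -> : rho (n - i) r = 0 by apply: contrapT => /hb; apply/negP.
by rewrite mulr0 big1 // => j _; case: ifP.
Qed.

(** The degree-0 component of 1 acts as a right identity on homogeneous elements,
    hence on all of R, so it equals 1. *)
Lemma rho_one j : rho j 1 = if j == 0 then 1 else 0.
Proof.
have id0 (x : R) : x * rho 0 1 = x.
  apply: (gr_eq grho) => n; have [b hb] := gr_fin grho x.
  rewrite {1}(gr_sum grho hb) mulr_suml (addf_sum (gr_add grho n)).
  rewrite [in RHS](gr_sum grho hb) (addf_sum (gr_add grho n)).
  apply: eq_bigr => m _; rewrite rho_mul (gr_proj grho) (gr_proj grho).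
  case: (eqVneq n m) => [->|nm]; last first.
    by rewrite ifF ?mulr0 //; lia.
  have := rho_mul m m x 1.
  by rewrite mulr1 subrr eqxx (gr_id grho).
have e1 : rho 0 1 = 1 by rewrite -[LHS]mul1r id0.
by rewrite -{1}e1 (gr_proj grho) e1.
Qed.

Section GradedModule.
Variables (M : rightModType R) (p : int -> M -> M).
Hypothesis hp : mod_graded rho p.
Let gp : grading p := hp.1.

Lemma p_ract n i v r : p n (p i v *> r) = p i v *> rho (n - i) r.
Proof.
have [b hb] := gr_fin grho r.
rewrite {1}(gr_sum grho hb) ract_sumr (addf_sum (gr_add gp n)).
have e j : p n (p i v *> rho j r) = if j == n - i then p i v *> rho (n - i) r else 0.
  rewrite -hp.2 (gr_proj gp).
  case: (eqVneq j (n - i)) => [->|h]; last by rewrite ifF //; lia.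
  by rewrite ifT ?hp.2 //; lia.
under eq_bigr => j _ do rewrite e.
have [nb|nb] := boolP (`|n - i| <= b)%N.
  by rewrite (sum_win1 nb) ?eqxx // => k /negPf->.
have -> : rho (n - i) r = 0 by apply: contrapT => /hb; apply/negP.
by rewrite ract0r big1 // => j _; case: ifP.
Qed.

Lemma rlin_homog (N : rightModType R) (f : M -> N) : additivef f ->
  (forall i j v r, f (p i v *> rho j r) = f (p i v) *> rho j r) -> rlin f.
Proof.
move=> af h; split=> // x r.
have [b hb] := gr_fin gp x; have [c hc] := gr_fin grho r.
rewrite {1}(gr_sum gp hb) {1}(gr_sum grho hc) ract_suml (addf_sum af).
rewrite [in RHS](gr_sum gp hb) (addf_sum af) ract_suml; apply: eq_bigr => i _.
rewrite ract_sumr (addf_sum af) [in RHS](gr_sum grho hc) ract_sumr.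
by apply: eq_bigr => j _.
Qed.

End GradedModule.

(** * Homogeneous components of a linear map *)

Section Components.
Variables (M N : rightModType R) (p : int -> M -> M) (q : int -> N -> N).
Hypotheses (hp : mod_graded rho p) (hq : mod_graded rho q).
Let gp : grading p := hp.1.
Let gq : grading q := hq.1.
Variable b : nat.
Hypothesis pb : supp_bound p b.

Definition hcomp (f : M -> N) (d : int) (v : M) : N :=
  \sum_(n <- win b) q (n + d) (f (p n v)).

Lemma hcompE f d n v : additivef f -> hcomp f d (p n v) = q (n + d) (f (p n v)).
Proof.
move=> af.
have e k : q (k + d) (f (p k (p n v))) = if k == n then q (n + d) (f (p n v)) else 0.
  rewrite (gr_proj gp); case: eqP => [->//|_]; by rewrite (addf0 af) (gr0 gq).
rewrite /hcomp; under eq_bigr => k _ do rewrite e.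
have [nb|nb] := boolP (`|n| <= b)%N.
  by rewrite (sum_win1 nb) ?eqxx // => k /negPf->.
have -> : p n v = 0 by apply: contrapT => /pb; apply/negP.
by rewrite (addf0 af) (gr0 gq) big1 // => k _; case: ifP.
Qed.

Lemma hcomp_rlin f d : rlin f -> rlin (hcomp f d).
Proof.
move=> lf; have af := rlin_add lf.
have ah : additivef (hcomp f d).
  move=> x y; rewrite -big_split; apply: eq_bigr => n _.
  by rewrite (gr_add gp) af (gr_add gq).
apply: (rlin_homog hp) => // i j v r.
rewrite -{1}hp.2 hcompE // hp.2 hcompE // rlinM //.
have [c hc] := gr_fin gq (f (p i v)).
rewrite {1}(gr_sum gq hc) ract_suml (addf_sum (gr_add gq _)).
have e' k : q (i + j + d) (q k (f (p i v)) *> rho j r) =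
   if k == i + d then q (i + d) (f (p i v)) *> rho j r else 0.
  rewrite (p_ract hq) (gr_proj grho).
  case: (eqVneq k (i + d)) => [->|h].
    by rewrite ifT //; lia.
  by rewrite ifF ?ract0r //; lia.
under eq_bigr => k _ do rewrite e'.
have [nb|nb] := boolP (`|(i + d)%R| <= c)%N.
  by rewrite (sum_win1 nb) ?eqxx // => k /negPf->.
have z : q (i + d) (f (p i v)) = 0 by apply: contrapT => /hc; apply/negP.
by rewrite z ract0l big1 // => k _; case: ifP.
Qed.

Lemma hcomp_deg f d n v : additivef f ->
  q (n + d) (hcomp f d (p n v)) = hcomp f d (p n v).
Proof. by move=> af; rewrite hcompE // (gr_id gq). Qed.

End Components.

(** The iterates of an injective g would move a nonzero homogeneous element out
    of the bounded support. *)
Lemma shift_not_inj (M : rightModType R) (p : int -> M -> M) b (g : M -> M) d :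
  mod_graded rho p -> supp_bound p b -> d != 0 ->
  (forall n v, p (n + d) (g (p n v)) = g (p n v)) -> additivef g -> injective g ->
  forall v : M, v = 0.
Proof.
move=> [gp _] pb d0 dg ag ig v; apply: (gr_eq gp) => n; rewrite (gr0 gp).
have it k : p (n + d *+ k) (iter k g (p n v)) = iter k g (p n v).
  elim: k => [|k IH]; first by rewrite mulr0n addr0 (gr_id gp).
  by rewrite iterS -IH mulrSr addrA dg.
have z : iter (2 * b + 1) g (p n v) = 0.
  apply: contrapT => nz; move: (it (2 * b + 1)%N) => h; rewrite -h in nz.
  have := pb _ _ nz.
  have [nb|nb] := boolP (`|n| <= b)%N.
    have : (0 < `|d|)%N by lia.
    rewrite -mulr_natr; nia.
  have pn : p n v = 0 by apply: contrapT => /pb; apply/negP.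
  case: nz; rewrite h pn.
  by elim: (2 * b + 1)%N => // k IH; rewrite iterS IH addf0.
elim: (2 * b + 1)%N z => // k IH; rewrite iterS => z; apply: IH; apply: ig.
by rewrite z addf0.
Qed.

Section GradedIndecomposable.
Variables (M : rightModType R) (p : int -> M -> M).
Hypothesis hp : mod_graded rho p.
Let gp : grading p := hp.1.
Variable b : nat.
Hypothesis pb : supp_bound p b.
Hypothesis artM : artinian M.
Hypothesis noeM : noetherian M.
Hypothesis indM : indec p [set: M].

Definition of_degree (d : int) (g : M -> M) :=
  forall n v, p (n + d) (g (p n v)) = g (p n v).

Lemma of_degree0 g : additivef g -> of_degree 0 g -> commutes p g.
Proof.
move=> ag dg n v; have [c hc] := gr_fin gp v.
rewrite {2}(gr_sum gp hc) (addf_sum ag) (addf_sum (gr_add gp n)).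
have e k : p n (g (p k v)) = if k == n then g (p n v) else 0.
  rewrite -dg addr0 (gr_proj gp) eq_sym; case: eqP => [->|//].
  by rewrite -{2}dg addr0.
under eq_bigr => k _ do rewrite e.
have [nb|nb] := boolP (`|n| <= c)%N.
  by rewrite (sum_win1 nb) ?eqxx // => k /negPf->.
have -> : p n v = 0 by apply: contrapT => /hc; apply/negP.
by rewrite (addf0 ag) big1 // => k _; case: ifP.
Qed.

Lemma of_degree_comp d e g h : of_degree d g -> of_degree e h -> of_degree (e + d) (g \o h).
Proof. by move=> dg dh n v; rewrite /= -(dh n v) addrA dg. Qed.

Lemma commutes_degree0 g : commutes p g -> of_degree 0 g.
Proof. by move=> cg n v; rewrite addr0 cg (gr_id gp). Qed.

(** A square system of homogeneous maps, the entry (k, n) having degree k - n,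
    with bijective diagonal entries has only the zero solution, by Gaussian
    elimination. A Schur complement changes a diagonal entry by a composite
    that factors through a map of nonzero degree; such a composite is not
    bijective, so by locality the diagonal entry stays bijective. *)
Lemma elimination (l : seq int) (a : int -> int -> M -> M) (y : int -> M) :
  uniq l -> (forall k n, rlin (a k n)) -> (forall k n, of_degree (k - n) (a k n)) ->
  (forall k, k \in l -> bijective (a k k)) ->
  (forall k, k \in l -> \sum_(n <- l) a k n (y n) = 0) ->
  forall k, k \in l -> y k = 0.
Proof.
elim: l a => // k0 l IH a /= /andP[k0l ul] la da bij sys.
have [inv iK Ki] := bij k0 (mem_head _ _).
have li : rlin inv := rlin_inv (la k0 k0) iK Ki.
have c0 : commutes p (a k0 k0).
  by apply: of_degree0 => [|n v]; [case: (la k0 k0)|have := da k0 k0 n v; rewrite subrr].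
have ci : commutes p inv.
  by move=> n v; apply: (can_inj iK); rewrite Ki c0 Ki.
pose s k n v := a k k0 (inv (a k0 n v)).
have ls k n : rlin (s k n).
  by apply: (rlin_comp (la k k0) (rlin_comp li (la k0 n))).
have ds k n : of_degree (k - n) (s k n).
  have -> : k - n = (k0 - n) + 0 + (k - k0) by lia.
  apply: (of_degree_comp (da k k0)); apply: (of_degree_comp _ (da k0 n)).
  exact: commutes_degree0.
pose a' k n v := a k n v - s k n v.
have yk0 : y k0 = - inv (\sum_(n <- l) a k0 n (y n)).
  apply: (can_inj iK); rewrite (addfN (rlin_add (la k0 k0))) Ki.
  apply/eqP; rewrite -addr_eq0; apply/eqP.
  by have := sys k0 (mem_head _ _); rewrite big_cons.
have yl : forall k, k \in l -> y k = 0.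
  apply: (IH a') => // [k n|k n m v|k kl|k kl].
  - exact: rlin_sub.
  - by rewrite /a' (grB gp) da ds.
  - have kk0 : k0 - k != 0.
      by rewrite subr_eq0; apply: contraNneq k0l => ->.
    have ca' : commutes p (a' k k).
      apply: of_degree0; first by case: (rlin_sub (la k k) (ls k k)).
      by move=> n v; rewrite /a' (grB gp) -{1}(subrr k) da -{1}(subrr k) ds.
    have cs : commutes p (s k k).
      by apply: of_degree0; [case: (ls k k)|move=> n v; rewrite -{1}(subrr k) ds].
    have [|||||ba|bs] := bij_add artM noeM (gr_add gp) indM (f := a' k k) (g := s k k) => //.
      exact: rlin_sub.
      by apply: (eq_bij (bij k _)) => [|v]; rewrite ?inE ?kl ?orbT // /a' subrK.
    have [[v _ /eqP nv] _] := indM; case: nv; move: v.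
    apply: (shift_not_inj hp pb kk0 (da k0 k)); first by case: (la k0 k).
    move=> x z e; apply: (bij_inj bs); by rewrite /s e.
  - rewrite sumrB; apply/eqP; rewrite subr_eq0; apply/eqP.
    have := sys k; rewrite inE kl orbT => /(_ isT); rewrite big_cons yk0.
    rewrite (addfN (rlin_add (la k k0))) addrC => /eqP; rewrite subr_eq0 => /eqP->.
    rewrite (rlin_sum _ _ _ li) (rlin_sum _ _ _ (la k k0)); by [].
move=> k; rewrite inE => /orP[/eqP->|/yl //].
rewrite yk0 big_seq big1 ?(rlin0 li) ?oppr0 // => n /yl ->; exact: rlin0.
Qed.

(** The equation f v = 0 says that the components of v solve the system whose
    matrix consists of the homogeneous components of f. *)
Lemma inj_of_component0 (f : M -> M) : rlin f -> bijective (hcomp p p b f 0) -> injective f.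
Proof.
move=> lf b0; apply: rlin_inj => // v fv.
have af := rlin_add lf.
apply: (gr_eq gp) => k; rewrite (gr0 gp).
have [nb|nb] := boolP (`|k| <= b)%N; last by apply: contrapT => /pb; apply/negP.
apply: (@elimination (win b) (fun k n => hcomp p p b f (k - n)) (fun n => p n v)).
- exact: uniq_win.
- by move=> i n; apply: (hcomp_rlin hp hp pb).
- by move=> i n m w; apply: (hcomp_deg hp hp pb).
- by move=> i _; rewrite subrr.
- move=> i _; under eq_bigr => n _ do rewrite (hcompE hp hp pb) // addrC subrK.
  rewrite -(addf_sum (gr_add gp _)) -(addf_sum af) -(gr_sum gp) ?fv ?(gr0 gp) //.
  by move=> n; apply: pb.
- by rewrite mem_win.
Qed.

(** A graded indecomposable module is thus indecomposable: by locality f or 1 - f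
    has a bijective component of degree 0 and is injective, and their composite
    is zero. *)
Lemma idempotent_trivial (f : M -> M) : rlin f -> (forall v, f (f v) = f v) ->
  (forall v, f v = 0) \/ (forall v, f v = v).
Proof.
move=> lf ff.
have lg : rlin (fun v => v - f v) := rlin_sub (rlin_id M) lf.
have c0 g : rlin g -> commutes p (hcomp p p b g 0).
  move=> lg'; apply: of_degree0; first by case: (hcomp_rlin hp hp pb 0 lg').
  by move=> n v; apply: (hcomp_deg hp hp pb); case: lg'.
have [|||||bf|bg] := bij_add artM noeM (gr_add gp) indM
    (f := hcomp p p b f 0) (g := hcomp p p b (fun v => v - f v) 0).
- exact: (hcomp_rlin hp hp pb).
- exact: (hcomp_rlin hp hp pb).
- exact: c0.
- exact: c0.
- exists id => v /=; rewrite /hcomp -big_split /= [RHS](gr_sum gp (pb^~ v)); apply: eq_bigr => n _;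
    by rewrite addr0 -(gr_add gp) addrC subrK (gr_id gp).
- by right=> v; apply: (inj_of_component0 lf bf).
- left=> v; apply: (inj_of_component0 lg bg); by rewrite ff subrr (rlin0 lf) subr0.
Qed.

End GradedIndecomposable.

(** The grading of an indecomposable module is unique up to a shift: the
    degree-0 component of g f = 1 is the sum of the composites of the component
    of f of degree d and that of g of degree - d. By locality one of them is
    bijective, and then the component of f of degree d is injective. *)
Lemma iso_degrees (X Y : rightModType R) (p : int -> X -> X) (q : int -> Y -> Y) b c
    (f : X -> Y) (g : Y -> X) :
  mod_graded rho p -> mod_graded rho q -> supp_bound p b -> supp_bound q c ->
  artinian X -> noetherian X -> indec p [set: X] ->
  rlin f -> rlin g -> cancel f g ->
  exists d, forall n v, p n v <> 0 -> exists w, q (n + d) w <> 0.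
Proof.
move=> hp hq pb qc artX noeX indX lf lg fg.
have [gp _] := hp; have [gq _] := hq.
have af := rlin_add lf; have ag := rlin_add lg.
pose F d := hcomp p q b f d; pose G d := hcomp q p c g d.
have lF d : rlin (F d) by apply: (hcomp_rlin hp hq pb).
have lG d : rlin (G d) by apply: (hcomp_rlin hq hp qc).
have FE d n v : F d (p n v) = q (n + d) (f (p n v)) by apply: (hcompE hp hq pb).
have GE d n v : G d (q n v) = p (n + d) (g (q n v)) by apply: (hcompE hq hp qc).
have [|||d _ bd] := @bij_sum R X p artX noeX (gr_add gp) indX int (win (b + c))
    (fun d => G (- d) \o F d).
- by move=> d; apply: rlin_comp.
- move=> d; apply: (of_degree0 hp); first by case: (rlin_comp (lG (- d)) (lF d)).
  by move=> n v; rewrite /= FE GE addrK addr0 (gr_id gp).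
- have sl : rlin (fun v => \sum_(d <- win (b + c)) (G (- d) \o F d) v).
    exact: (rlin_sumf _ (F := fun d => G (- d) \o F d) (fun d => rlin_comp (lG _) (lF d))).
  suff e v : \sum_(d <- win (b + c)) (G (- d) \o F d) v = v.
    by exists id => v /=; rewrite e.
  have e n : \sum_(d <- win (b + c)) (G (- d) \o F d) (p n v) = p n v.
    under eq_bigr => d _ do rewrite /= FE GE addrK.
    rewrite -(addf_sum (gr_add gp n)) -(addf_sum ag).
    have [nb|nb] := boolP (`|n| <= b)%N; last first.
      have -> : p n v = 0 by apply: contrapT => /pb; apply/negP.
      rewrite big1 ?(rlin0 lg) ?(gr0 gp) // => d _.
      by rewrite (rlin0 lf) (gr0 gq).
    have -> : \sum_(d <- win (b + c)) q (n + d) (f (p n v)) = f (p n v).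
      under eq_bigr => d _ do rewrite addrC.
      have wc k : q k (f (p n v)) <> 0 -> (`|k| <= c)%N by apply: qc.
      rewrite (sum_win_shift (F := fun k => q k (f (p n v)))) => [|k /wc|k /wc]; try lia.
      by rewrite -(gr_sum gq) // => k /wc; lia.
    by rewrite fg (gr_id gp).
  rewrite {1}(gr_sum gp (pb^~ v)) (rlin_sum _ _ _ sl) [RHS](gr_sum gp (pb^~ v)).
  by apply: eq_bigr => n _; rewrite e.
exists d => n v nz; exists (f (p n v)) => z; apply: nz.
apply: (bij_inj bd); rewrite /= FE z (rlin0 (lF d)) (rlin0 (lG _)) //.
Qed.

End GradedRing.

(** * A graded right artinian ring has finite support *)

Section FiniteSupport.
Variables (R : pzRingType) (rho : int -> R -> R).
Hypothesis hrho : ring_graded rho.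
Let grho : grading rho := hrho.1.
Notation Rr := (regr R).

Definition graded_ideal (A : set Rr) := forall n (x : R), A x -> A (rho n x).

Lemma graded_idealP (A : set Rr) (x : R) : submod A ->
  (forall n, A (rho n x)) -> A x.
Proof.
move=> sA h; have [b hb] := gr_fin grho x; rewrite (gr_sum grho hb).
by elim/big_rec: _ => [|n y _ Ay]; [exact: submod_zero|exact: submod_add].
Qed.

(** Let m be a proper graded right ideal and s homogeneous of nonzero degree
    such that sr lies in m exactly when r does. Then the right ideals
    (1 - s)^N R + m form a strictly decreasing chain: otherwise 1 - s would
    have a right inverse z modulo m, and comparing components z would have the
    infinitely many nonzero components 1, s, s^2 and so on. *)
Lemma no_self_shift (m : set Rr) (s : R) (d : int) : artinian Rr ->
  submod m -> graded_ideal m -> ~ m 1 -> d != 0 -> rho d s = s ->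
  (forall r : R, m r <-> m (s * r)) -> False.
Proof.
move=> art sm gm m1 d0 sd ms.
have ms1 (r : R) : m r -> m (s * r) by case: (ms r).
have ms2 (r : R) : m (s * r) -> m r by case: (ms r).
have rhos n (w : R) : rho n (s * w) = s * rho (n - d) w by rewrite -sd rho_mul // sd.
have mB (x y : R) : m x -> m y -> m (x - y) by apply: submod_sub.
have mD (x y : R) : m x -> m y -> m (x + y) by apply: submod_add.
have m0 : m (0 : R) by apply: submod_zero.
have inj (w : R) : m (w - s * w) -> m w.
  move=> mw; apply: graded_idealP => // n; have [b hb] := gr_fin grho w.
  have step k : m (rho (k - d) w) -> m (rho k w).
    move=> h; rewrite -[rho k w](subrK (s * rho (k - d) w)).
    by apply: mD; [rewrite -rhos -(grB grho); apply: gm|apply: ms1].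
  have far j : m (rho (n - d *+ j) w) -> m (rho n w).
    elim: j => [|j IH]; first by rewrite mulr0n subr0.
    by rewrite mulrSr opprD addrA => /step.
  apply: (far (`|n| + b + 1)%N).
  suff -> : rho (n - d *+ (`|n| + b + 1)) w = 0 by [].
  apply: contrapT => /hb; have : (0 < `|d|)%N by lia.
  rewrite -mulr_natr; nia.
pose I N := [set x : Rr | exists z : R, m ((x : R) - (1 - s) ^+ N * z)].
have [N|N x [z mz]|N hN] := art I.
- split.
  + by exists 0; rewrite mulr0 subrr.
  + move=> x y [z mz] [w mw]; exists (z + w).
    by rewrite mulrDr opprD addrACA; apply: mD.
  + move=> x r [z mz]; exists (z * r).
    by rewrite mulrA -mulrBl; apply: submod_mulr.
- by exists ((1 - s) * z); rewrite mulrA -exprSr.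
have [|z] := hN N.+1 (leqnSn N) ((1 - s) ^+ N : R).
  by exists 1; rewrite mulr1 subrr.
rewrite exprSr -mulrA -{1}[(1 - s) ^+ N]mulr1 -mulrBr.
(* 1 - s acts injectively modulo m, so its powers can be cancelled. *)
have peel w : m ((1 - s) ^+ N * w) -> m w.
  elim: N {hN} => [|N IH]; first by rewrite expr0 mul1r.
  by rewrite exprS -mulrA [X in m X]mulrBl mul1r => /inj.
move=> /peel; rewrite mulrBl mul1r => mz.
pose c (j : int) := rho (d * j) z.
have [b hb] := gr_fin grho z.
have crel j : m (rho (d * j) 1 - (c j - s * c (j - 1))).
  rewrite /c mulrBr mulr1 -rhos -!(grB grho); exact: gm.
have cz j : (b < `|j|)%N -> c j = 0.
  move=> bj; apply: contrapT => /hb; rewrite abszM.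
  have : (0 < `|d|)%N by lia.
  nia.
have rel j : j != 0 -> m (c j - s * c (j - 1)).
  move=> j0; have := crel j; rewrite rho_one // mulf_eq0 (negPf d0) (negPf j0) sub0r.
  by move/(submodN sm); rewrite opprK.
have neg k : m (c (- (b + 1)%:Z + k%:Z)) \/ 0 <= - (b + 1)%:Z + k%:Z.
  elim: k => [|k [IH|IH]]; last by right; lia.
    by left; rewrite cz //; lia.
  have [k0|k0] := leP 0 (- (b + 1)%:Z + k.+1%:Z); first by right.
  left; rewrite -[c _](subrK (s * c (- (b + 1)%:Z + k%:Z))); apply: mD; last exact: ms1.
  have -> : - (b + 1)%:Z + k%:Z = - (b + 1)%:Z + k.+1%:Z - 1 by lia.
  by apply: rel; lia.
have cm1 : m (c (- 1)).
  case: (neg b); last by lia.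
  by have -> : - (b + 1)%:Z + b%:Z = - 1 by lia.
have c0 : ~ m (c 0).
  move=> h; apply: m1; have := crel 0; rewrite mulr0 rho_one // eqxx sub0r => h'.
  rewrite -[1](subrK (c 0 - s * c (- 1))); apply: mD => //; apply: mB => //.
  exact: ms1.
have cpos (k : nat) : ~ m (c k).
  elim: k => // k IH h; apply: IH; apply: ms2.
  rewrite -[s * _](subKr (c k.+1)); apply: mB => //.
  by have := rel k.+1 isT; have -> : k.+1%:Z - 1 = k by lia.
by apply: (cpos b.+1); rewrite cz.
Qed.

(** Let K be maximal among the graded right ideals of finite support. Were it not
    R, there would be a graded right ideal K' such that K'/K is graded simple, of
    infinite support. The annihilators modulo K of homogeneous elements y_0,
    y_1, ... of K' of distinct degrees cannot have strictly decreasing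
    intersections, which yields an isomorphism of K'/K with a shift of itself,
    given by a homogeneous s as in the previous lemma. *)
Lemma ring_supp_bound : artinian Rr -> noetherian Rr -> exists b, supp_bound rho b.
Proof.
move=> art noe.
pose fin (A : set Rr) b := forall n (x : R), A x -> rho n x <> 0 -> (`|n| <= b)%N.
have [|K [sK [gK [b0 hK]] maxK]] :=
    noetherian_max (P := fun A => graded_ideal A /\ exists b, fin A b) noe.
  exists [set x | x = 0]; split; last split.
  - by split=> //= [x y -> ->|x r ->]; rewrite ?addr0 ?ract0l.
  - by move=> n x /= ->; rewrite (gr0 grho).
  - by exists 0%N => n x /= ->; rewrite (gr0 grho).
have [K1|nK1] := pselect (K 1).
  by exists b0 => n x; apply: hK; rewrite -[x]mul1r; apply: submod_mulr.
exfalso.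
have [|K' [sK' [gK' KK' nK'] minK']] :=
    artinian_min (P := fun A => [/\ graded_ideal A, K `<=` A & ~ A `<=` K]) art.
  by exists setT; split=> //; split=> // /(_ 1 I).
have KD (x y : R) : K x -> K y -> K (x + y) by apply: submod_add.
have KB (x y : R) : K x -> K y -> K (x - y) by apply: submod_sub.
have KM (x y : R) : K x -> K (x * y) by apply: submod_mulr.
have infK' b : exists ny : int * R,
    [/\ (b < `|ny.1|)%N, K' ny.2, rho ny.1 ny.2 = ny.2 & ~ K ny.2].
  apply: contrapT => H; apply: nK'; apply: maxK => //; split=> //.
  exists (maxn b b0) => n x K'x nz; rewrite leq_max; apply/orP.
  have [nb|nb] := leqP `|n| b; [by left|right].
  have [Kx|nKx] := pselect (K (rho n x)).
    by apply: (hK n (rho n x)) => //; rewrite (gr_id grho).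
  by case: H; exists (n, rho n x); split=> //=; [apply: gK'|rewrite (gr_id grho)].
have [f hf] := choice infK'.
pose s k := iter k (fun ny => f `|ny.1|%N) (f 0%N).
pose dg k := (s k).1; pose y k := (s k).2.
have sP k : [/\ K' (y k), rho (dg k) (y k) = y k & ~ K (y k)].
  rewrite /dg /y; case: k => [|k]; first by have [] := hf 0%N.
  by rewrite /s iterS; have [] := hf `|(s k).1|%N.
have dgS k : (`|dg k| < `|dg k.+1|)%N by rewrite /dg /s iterS; case: (hf `|(s k).1|%N).
have dg_lt i k : (i < k)%N -> (`|dg i| < `|dg k|)%N.
  by elim: k => // k IH; rewrite ltnS leq_eqVlt => /orP[/eqP->|/IH/ltn_trans]; [exact: dgS|apply].
have rhoy k n (r : R) : rho n (y k * r) = y k * rho (n - dg k) r.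
  by have [_ e _] := sP k; rewrite -e rho_mul // e.
pose A k := [set r : Rr | forall i, (i < k)%N -> K (y i * (r : R))].
have sA k : submod (A k).
  split.
  - by move=> i _; rewrite mulr0; apply: submod_zero.
  - by move=> a b ha hb i ik; rewrite mulrDr; apply: KD; [apply: ha|apply: hb].
  - by move=> a r ha i ik; rewrite mulrA; apply: KM; apply: ha.
have gA k : graded_ideal (A k).
  move=> n r h i ik; have := gK (dg i + n) _ (h i ik).
  by rewrite rhoy; have -> : dg i + n - dg i = n by lia.
have [//|k r h i ik|t ht] := art A; first by apply: h; apply: ltnW.
have At : A t `<=` [set r : Rr | K (y t * (r : R))].
  by move=> r Ar; apply: (ht t.+1 (leqnSn t) r Ar).
have [i [it Ai nAi]] : exists i, [/\ (i < t)%N,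
    A i.+1 `<=` [set r : Rr | K (y t * (r : R))] &
    ~ A i `<=` [set r : Rr | K (y t * (r : R))]].
  have nA0 : ~ A 0%N `<=` [set r : Rr | K (y t * (r : R))].
    move=> h; have [_ _ nK] := sP t; apply: nK; rewrite -[y t]mulr1.
    by apply: (h 1) => j.
  have : exists j, (j <= t)%N /\ A j `<=` [set r : Rr | K (y t * (r : R))] by exists t.
  case; elim=> [|j IH] [jt Aj]; first by case: nA0.
  have [h|h] := pselect (A j `<=` [set r : Rr | K (y t * (r : R))]).
    by apply: IH; split=> //; apply: ltnW.
  by exists j.
have [a0 [Aa0 nKa0]] : exists a, A i a /\ ~ K (y t * (a : R)).
  by apply: contrapT => H; apply: nAi => a Aa; apply: contrapT => nKa; apply: H; exists a.
have [n nKn] : exists n, ~ K (y t * rho n a0).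
  apply: contrapT => H; apply: nKa0; apply: graded_idealP => // k.
  by rewrite rhoy; apply: contrapT => H'; apply: H; exists (k - dg t).
pose a := rho n a0; have Aa : A i a by apply: gA.
pose u := y i * a; pose v := y t * a.
have nKv : ~ K v by [].
have rhou k (r : R) : rho k (u * r) = u * rho (k - (dg i + n)) r.
  by rewrite /u -mulrA rhoy /a rho_mul // mulrA opprD addrA.
have rhov : rho (dg t + n) v = v.
  by rewrite /v rhoy addrC addKr (gr_id grho).
have K'u : K' u by apply: submod_mulr => //; case: (sP i).
have K'v : K' v by apply: submod_mulr => //; case: (sP t).
have AK (r : R) : K (u * r) -> K (v * r).
  move=> Ku; rewrite /v -mulrA; apply: Ai => j; rewrite ltnS leq_eqVlt => /orP[/eqP->|ji].
    by rewrite mulrA.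
  by rewrite mulrA; apply: KM; apply: Aa.
have nKu : ~ K u by move=> Ku; apply: nKv; rewrite -[v]mulr1; apply: AK; rewrite mulr1.
have span (w : R) k : K' w -> ~ K w -> (forall l (r : R), rho l (w * r) = w * rho (l - k) r) ->
    forall x : R, K' x -> exists r : R, K (x - w * r).
  move=> K'w nKw hw x K'x.
  have [||e [r [Ke ->]]] := minK' (addcyc K (w : Rr)) (submod_addcyc _ sK) _ _ x K'x.
  - split.
    + move=> l _ [e [r [Ke ->]]]; exists (rho l e), (rho (l - k) r); split; first exact: gK.
      by rewrite (gr_add grho) hw.
    + exact: sub_addcyc.
    + by move=> /(_ w); apply: contra_not nKw; apply; apply: addcyc_gen.
  - by apply: addcyc_min.
  - by exists r; rewrite -[_ *> _]/(w * r) addrK.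
have [r Kr] := span u _ K'u nKu rhou v K'v.
pose d := dg t - dg i; pose q := rho d r.
have Kq : K (v - u * q).
  have := gK (dg t + n) _ Kr; rewrite (grB grho) rhov rhou.
  by have -> : dg t + n - (dg i + n) = d by rewrite /d; lia.
pose m := [set x : Rr | K (u * (x : R))].
have sm : submod m.
  split.
  - by rewrite /m /= mulr0; apply: submod_zero.
  - by move=> x z mx mz; rewrite /m /= mulrDr; apply: KD.
  - by move=> x z mx; rewrite /m /= mulrA; apply: KM.
have gm : graded_ideal m.
  move=> k x mx; have := gK (dg i + n + k) _ mx; rewrite rhou.
  by have -> : dg i + n + k - (dg i + n) = k by lia.
have mq (x : R) : m x -> m (q * x).
  move=> /AK Kvx; rewrite /m /= mulrA -[u * q](subKr v) mulrBl.
  by apply: KB => //; apply: KM.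
have nmq : ~ m q by move=> h; apply: nKv; rewrite -[v](subrK (u * q)); apply: KD.
have d0 : d != 0.
  by rewrite subr_eq0; apply/eqP => h; have := dg_lt i t it; rewrite h ltnn.
apply: (@no_self_shift m q d) => //; first by rewrite /m /= mulr1.
  exact: (gr_id grho).
move=> x; split; first exact: mq.
move=> mqx; apply: graded_idealP => // k; apply: contrapT => nmx.
have mqk : m (q * rho k x).
  have := gm (d + k) _ mqx; rewrite {1}/q rho_mul //.
  by have -> : d + k - d = k by lia.
have [||z Kz] := span (u * rho k x) (dg i + n + k) _ nmx _ u K'u.
- exact: submod_mulr.
- move=> l z; rewrite -mulrA rhou rho_mul // mulrA.
  by congr (_ * rho _ _); lia.
apply: nmq.
have : m (q * (1 - rho k x * z) + q * rho k x * z).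
  apply: submod_add => //; last exact: submod_mulr.
  by apply: mq; rewrite /m /= mulrBr mulr1 mulrA.
by rewrite mulrBr mulr1 mulrA subrK.
Qed.

End FiniteSupport.

(** * Submodules as modules *)

Section SubmoduleType.
Variables (R : pzRingType) (M : rightModType R) (A : set M) (sA : submod A).

Definition sub_pred of submod A : {pred M} := [pred v : M | `[< A v >]].

Lemma sub_predP : submod_closed (sub_pred sA).
Proof.
split; first by apply/asboolP; apply: submod0.
move=> r x y /asboolP Ax /asboolP Ay; apply/asboolP.
by apply: submodD => //; exact: (@submodM _ _ _ x r sA Ax).
Qed.

HB.instance Definition _ := GRing.isSubmodClosed.Build _ M (sub_pred sA) sub_predP.

Record subm : Type := Subm { subm_val : M; _ : subm_val \in sub_pred sA }.
HB.instance Definition _ := [isSub for subm_val].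
HB.instance Definition _ := [Choice of subm by <:].
HB.instance Definition _ := [SubChoice_isSubLmodule of subm by <:].

Definition subM : rightModType R := subm.

Lemma subm_mem (x : subM) : A (subm_val x).
Proof. by apply/asboolP; apply: (valP (x : subm)). Qed.

Definition to_sub (v : M) : subM := insubd (0 : subm) v.

Lemma to_subK v : A v -> subm_val (to_sub v) = v.
Proof. by move=> Av; rewrite /to_sub -[subm_val]/val insubdK //; apply/asboolP. Qed.

Lemma subm_inj : injective (subm_val : subM -> M).
Proof. exact: val_inj. Qed.

Lemma rlin_subm : rlin (subm_val : subM -> M).
Proof. by split. Qed.

Lemma rlin_to_sub (N : rightModType R) (f : N -> M) : rlin f -> (forall v, A (f v)) ->
  rlin (to_sub \o f).
Proof.
move=> lf Af; split=> [x y|x r]; apply: subm_inj.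
  by rewrite (rlinD _ _ rlin_subm) ![(to_sub \o f) _]/= !to_subK // rlinD.
by rewrite (rlinM _ _ rlin_subm) ![(to_sub \o f) _]/= !to_subK // rlinM.
Qed.

Section SubGrading.
Variable p : int -> M -> M.
Hypothesis pA : stable_under p A.

Definition sub_proj (n : int) (x : subM) : subM := to_sub (p n (subm_val x)).

Lemma sub_projE n x : subm_val (sub_proj n x) = p n (subm_val x).
Proof. by rewrite to_subK //; apply: pA; apply: subm_mem. Qed.

Lemma indec_sub : indec p A -> indec sub_proj [set: subM].
Proof.
move=> [[v Av v0] ind]; split.
  exists (to_sub v) => //; apply: contraNneq v0 => z.
  by rewrite -(to_subK Av) z; apply/eqP; apply: (rlin0 rlin_subm).
move=> B C sB sC pB pC _ _ hs h0.
pose im (B : set subM) := [set v | exists2 x, B x & subm_val x = v].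
have sim D : submod D -> submod (im D).
  move=> sD; split; first by exists 0; [exact: submod0|exact: (rlin0 rlin_subm)].
    move=> _ _ [x Dx <-] [y Dy <-]; exists (x + y); first exact: submodD.
    exact: (rlinD _ _ rlin_subm).
  move=> _ r [x Dx <-]; exists (x *> r); first exact: submodM.
  exact: (rlinM _ _ rlin_subm).
have pim D : stable_under sub_proj D -> stable_under p (im D).
  by move=> pD n _ [x Dx <-]; exists (sub_proj n x); [apply: pD|rewrite sub_projE].
have imA D : im D `<=` A by move=> _ [x _ <-]; apply: subm_mem.
have red D : (forall v, im D v -> v = 0) -> forall x, D x -> x = 0.
  by move=> h x Dx; apply: subm_inj; rewrite (rlin0 rlin_subm); apply: h; exists x.
have [] := ind (im B) (im C) (sim B sB) (sim C sC) (pim B pB) (pim C pC) (imA B) (imA C).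
- move=> w Aw; have [b [c [Bb Cc e]]] := hs (to_sub w) I.
  exists (subm_val b), (subm_val c); split; [by exists b|by exists c|].
  by rewrite -(rlinD _ _ rlin_subm) -e to_subK.
- move=> _ [x Bx <-] [y Cy e]; have -> : x = 0; last exact: (rlin0 rlin_subm).
  by apply: h0 => //; rewrite -(subm_inj e).
- by move=> /red h; left.
- by move=> /red h; right.
Qed.

End SubGrading.
End SubmoduleType.
Arguments sub_proj {R M A} sA p n x.
Arguments to_sub {R M A} sA v.
Arguments subm_val {R M A sA} _ : rename.
Arguments rlin_subm {R M A} sA.
Arguments subm_inj {R M A} sA.

(** Only on A do the maps p n have to form a grading: M may be a product, whose
    elements are not finite sums of their components. *)
Lemma sub_graded (R : pzRingType) (rho : int -> R -> R) (M : rightModType R) (A : set M)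
    (sA : submod A) (p : int -> M -> M) : stable_under p A ->
  (forall n, additivef (p n)) ->
  (forall m n v, p m (p n v) = if m == n then p n v else 0) ->
  (forall v, A v -> exists b, v = \sum_(n <- win b) p n v) ->
  (forall i j v r, p (i + j) (p i v *> rho j r) = p i v *> rho j r) ->
  mod_graded rho (sub_proj sA p).
Proof.
move=> pA ap pp ps pr; split; first split.
- move=> n x y; apply: (subm_inj sA).
  by rewrite (rlinD _ _ (rlin_subm sA)) !sub_projE // (rlinD _ _ (rlin_subm sA)) ap.
- move=> m n v; apply: (subm_inj sA); rewrite !sub_projE // pp.
  by case: eqP => _; rewrite ?sub_projE // (rlin0 (rlin_subm sA)).
- move=> v; have [b hb] := ps _ (subm_mem v); exists b; apply: (subm_inj sA).
  by rewrite (rlin_sum _ _ _ (rlin_subm sA)) {1}hb; apply: eq_bigr => n _; rewrite sub_projE.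
- move=> i j v r; apply: (subm_inj sA).
  by rewrite !(sub_projE, (rlinM _ _ (rlin_subm sA))) // pr.
Qed.

(** * The bridge between graded modules and modules with projections *)

Section Bridge.
Variables (R : pzRingType) (Rgr : int -> {pred R}) (rho : int -> R -> R).
Hypothesis rhoE : forall n x, x \in Rgr n <-> rho n x = x.

Section OfProjections.
Variables (M : rightModType R) (p : int -> M -> M).
Hypothesis hp : mod_graded rho p.

Lemma of_projections_ract i j (v : M) (r : R) :
  v \in [pred v | p i v == v] -> r \in Rgr j -> v *> r \in [pred v | p (i + j) v == v].
Proof. by rewrite !inE => /eqP <- /rhoE <-; rewrite hp.2. Qed.

Definition graded_of_projections : gradedModule Rgr :=
  GradedModule (grading_direct_sum hp.1) of_projections_ract.

End OfProjections.

Lemma graded_submoduleP (X : gradedModule Rgr) (p : int -> X -> X) (A : {pred X}) :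
  grading p -> (forall n v, v \in gm_comp X n <-> p n v = v) ->
  graded_submodule A ->
  submod [set v | v \in A] /\ stable_under p [set v | v \in A].
Proof.
move=> gp pE [[A0 lA] hA].
have sA : submod [set v | v \in A].
  split=> //= [x y Ax Ay|x r Ax]; first by rewrite -[x]scale1r; apply: lA.
  by rewrite -[_ *> _]addr0; apply: lA.
split=> // n v /= Av; have [c [cA ev]] := hA v Av.
have [b hb] := fsfun_fin c.
rewrite ev (fsfun_sumE hb) (addf_sum (gr_add gp n)).
apply: (submod_sum (A := [set v | v \in A])) => // k _ /=.
have [Ak /pE ck] := cA k; rewrite -ck (gr_proj gp) ck.
by case: eqP => _ //; apply: submod0 sA.
Qed.

Lemma graded_indecomposable_of_indec (X : gradedModule Rgr) (p : int -> X -> X) :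
  grading p -> (forall n v, v \in gm_comp X n <-> p n v = v) ->
  indec p [set: X] -> graded_indecomposable X.
Proof.
move=> gp pE [[v0 _ nv0] h]; split; first by exists v0.
move=> A B gA gB [hs h0].
have [sA pA] := graded_submoduleP gp pE gA; have [sB pB] := graded_submoduleP gp pE gB.
have z (C : {pred X}) : submod [set v | v \in C] -> (forall v, v \in C -> v = 0) -> C =i pred1 0.
  move=> sC hC v; rewrite [RHS]inE; apply/idP/eqP => [/hC//|->]; exact: submod0 sC.
have [||h'|h'] := h _ _ sA sB pA pB (fun _ _ => I) (fun _ _ => I).
- by move=> v _; have [a [b [? ? ?]]] := hs v; exists a, b.
- exact: h0.
- by left; apply: z.
- by right; apply: z.
Qed.

End Bridge.

(** * Every finitely generated module is a retract of a graded one *)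

Section FinitelyGenerated.
Variables (R : pzRingType) (rho : int -> R -> R).
Hypothesis hrho : ring_graded rho.
Hypothesis artR : right_artinian R.

Lemma fg_of_finType (M : rightModType R) (I : finType) (g : I -> M) :
  (forall v, exists a : I -> R, v = \sum_i g i *> a i) -> finitely_generated M.
Proof.
move=> h; exists #|I|, (g \o enum_val) => v; have [a ->] := h v.
exists (a \o enum_val); rewrite (reindex (@enum_val I predT)) //.
exact/onW_bij/enum_val_bij.
Qed.

Lemma fg_image (M N : rightModType R) (f : M -> N) : rlin f -> (forall y, exists x, f x = y) ->
  finitely_generated M -> finitely_generated N.
Proof.
move=> lf sf [k [g hg]]; exists k, (f \o g) => y; have [x <-] := sf y.
have [a ->] := hg x; exists a; rewrite (rlin_sum _ _ _ lf).
by apply: eq_bigr => i _; rewrite (rlinM _ _ lf).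
Qed.

Lemma fg_supp_bound (M : rightModType R) (p : int -> M -> M) d : supp_bound rho d ->
  mod_graded rho p -> finitely_generated M -> exists b, supp_bound p b.
Proof.
move=> hd hp [k [g hg]]; have gp := hp.1.
have [f hf] := choice (fun i => gr_fin gp (g i)).
exists (\max_(i < k) f i + d)%N => n v; have [a ->] := hg v.
rewrite (addf_sum (gr_add gp n)) => nz; rewrite leqNgt; apply/negP => nb; apply: nz.
rewrite big1 // => i _.
rewrite {1}(gr_sum gp (hf i)) ract_suml (addf_sum (gr_add gp n)).
rewrite big_seq big1 // => m; rewrite mem_win => mi.
rewrite (p_ract hrho hp).
have -> : rho (n - m) (a i) = 0; last by rewrite ract0r.
apply: contrapT => /hd h; have fi : (f i <= \max_(j < k) f j)%N by apply: leq_bigmax.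
move: nb fi; set x := \max_(j < k) f j => nb fi; lia.
Qed.

Lemma fg_fixed (M : rightModType R) (p : int -> M -> M) (e : M -> M) (ie : idem p e) :
  finitely_generated M -> finitely_generated (subM (submod_fixed ie)).
Proof.
have [le ce ee] := ie; apply: (fg_image (f := to_sub (submod_fixed ie) \o e)).
  by apply: rlin_to_sub.
move=> y; exists (subm_val y); apply: (subm_inj (submod_fixed ie)).
by rewrite /= to_subK; [apply: (subm_mem y)|apply: ee].
Qed.

Lemma mod_graded_fixed (M : rightModType R) (p : int -> M -> M) (e : M -> M) (ie : idem p e) :
  mod_graded rho p ->
  stable_under p (fixed e) /\ mod_graded rho (sub_proj (submod_fixed ie) p).
Proof.
move=> hp; have [le ce ee] := ie.
have pe : stable_under p (fixed e) by move=> n v; rewrite /fixed /= ce => ->.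
have [[ap pp ps] pr] := hp.
split=> //; exact: (sub_graded _ pe ap pp (fun v _ => ps v) pr).
Qed.

Definition length_bound (G : nat) := forall (Y : rightModType R) (p : int -> Y -> Y),
  mod_graded rho p -> finitely_generated Y -> indec p [set: Y] ->
  forall n m v w, p n v <> 0 -> p m w <> 0 -> n - m < G%:Z.

(** Q projects onto the indecomposable summands of X having a nonzero component
    in some degree at most c; these vanish in degrees at least c + G. *)
Lemma cut_endomorphism (X : rightModType R) (p : int -> X -> X) (G : nat) (c : int) :
  length_bound G -> mod_graded rho p -> finitely_generated X ->
  exists Q : X -> X, [/\ rlin Q, commutes p Q,
    forall n v, n <= c -> Q (p n v) = p n v &
    forall n v, c + G%:Z <= n -> Q (p n v) = 0].
Proof.
move=> hG hp fgX; have gp := hp.1.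
pose P (e : X -> X) := exists Q : X -> X, [/\ rlin Q, commutes p Q,
    forall n v, n <= c -> Q (p n v) = e (p n v) &
    forall n v, c + G%:Z <= n -> Q (p n v) = 0].
suff H e : idem p e -> P e by apply: (H id); split.
move: e; apply: (idem_ind (fg_artinian artR fgX) (gr_add gp)).
- move=> e [le ce _] e0; exists e; split=> // n v _; exact: e0.
- move=> e ie inde.
  have [pe hpe] := mod_graded_fixed ie hp.
  have bnd := hG _ _ hpe (fg_fixed ie fgX) (indec_sub (submod_fixed ie) pe inde).
  case: (ie) => le ce ee.
  have nz n v : e (p n v) <> 0 ->
      sub_proj (submod_fixed ie) p n (to_sub (submod_fixed ie) (e v)) <> 0.
    move=> nz z; apply: nz; rewrite ce -(to_subK (submod_fixed ie) (ee v)) -sub_projE //.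
    by rewrite z (rlin0 (rlin_subm _)).
  have [[n0 [v0 [n0c /nz e0]]]|H] :=
    pselect (exists n v, n <= c /\ e (p n v) <> 0).
    exists e; split=> // n v nc; apply: contrapT => /nz /bnd /(_ e0); lia.
  exists (fun=> 0); split=> //.
  + by split=> [x y|x r]; rewrite ?addr0 ?ract0l.
  + by move=> n v; rewrite (gr0 gp).
  + by move=> n v nc; apply/esym; apply: contrapT => z; apply: H; exists n, v.
- move=> e e1 e2 _ _ _ eE _ _ [Q1 [l1 c1 i1 z1]] [Q2 [l2 c2 i2 z2]].
  exists (fun v => Q1 v + Q2 v); split; first exact: rlin_addf.
  + by move=> n v; rewrite c1 c2 (gr_add gp).
  + by move=> n v nc; rewrite i1 // i2 // eE.
  + by move=> n v nc; rewrite z1 // z2 // addr0.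
Qed.

(** By locality M is a retract of a graded summand of X that is indecomposable
    as a graded module. This summand is then indecomposable, so M is isomorphic
    to it. The composite al be is the graded projection onto the summand. *)
Lemma graded_retract (M : rightModType R) (o : int -> M -> M)
    (X : rightModType R) (q : int -> X -> X) (b : nat) (s : M -> X) (t : X -> M) :
  (forall n v, o n v = v) -> finitely_generated M -> indec o [set: M] ->
  mod_graded rho q -> finitely_generated X -> supp_bound q b ->
  rlin s -> rlin t -> (forall v, t (s v) = v) ->
  exists (al : M -> X) (be : X -> M), [/\ rlin al, rlin be, forall v, be (al v) = v &
    commutes q (fun x => al (be x))].
Proof.
move=> o1 fgM indM hq fgX qb ls lt ts; have gq := hq.1.
have oadd n : additivef (o n) by move=> x y; rewrite !o1.
have co f : commutes o f by move=> n v; rewrite !o1.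
have bij_or f g := @bij_add R M o (fg_artinian artR fgM) (fg_noetherian artR fgM) oadd indM f g.
pose P (e : X -> X) := forall (al : M -> X) (be : X -> M), rlin al -> rlin be ->
    bijective (fun v : M => be (e (al v)) : M) ->
    exists (al : M -> X) (be : X -> M), [/\ rlin al, rlin be, forall v : M, be (al v) = v &
      commutes q (fun x => al (be x))].
suff H e : idem q e -> P e.
  have iid : idem q id by split.
  by apply: (H id iid s t) => //; exists id => v /=.
move: e; apply: (idem_ind (fg_artinian artR fgX) (gr_add gq)).
- move=> e [le _ _] e0 al be la lb [g gK _].
  have [[v _ /eqP nv] _] := indM; case: nv.
  by rewrite -[v]gK -[RHS]gK !e0.
- move=> e ie inde al be la lb [u uK Ku].
  case: (ie) => le ce ee.
  have [qe hqe] := mod_graded_fixed ie hq.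
  set se := submod_fixed ie.
  have fge := fg_fixed ie fgX.
  have lu : rlin u := rlin_inv (rlin_comp lb (rlin_comp le la)) uK Ku.
  pose al1 v := to_sub se (e (al v)); pose be1 (x : subM se) := u (be (subm_val x)).
  have fe v : fixed e (e (al v)) by apply: ee.
  have la1 : rlin al1 by apply: (rlin_to_sub se (rlin_comp le la) fe).
  have lb1 : rlin be1 := rlin_comp lu (rlin_comp lb (rlin_subm se)).
  have ba v : be1 (al1 v) = v by rewrite /be1 /al1 to_subK //; apply: uK.
  have seb : supp_bound (sub_proj se q) b.
    move=> n v nz; apply: (qb n (subm_val v)) => z; apply: nz; apply: (subm_inj se).
    by rewrite sub_projE // z (rlin0 (rlin_subm se)).
  have [z|id1] := idempotent_trivial hrho hqe seb (fg_artinian artR fge)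
    (fg_noetherian artR fge) (indec_sub (submod_fixed ie) qe inde) (rlin_comp la1 lb1)
    (fun x => congr1 al1 (ba (be1 x))).
    have [[v _ /eqP nv] _] := indM; case: nv.
    have h : al1 v = 0 by rewrite -[v]ba; apply: z.
    by rewrite -[v]ba h (rlin0 lb1).
  exists (fun v => subm_val (al1 v)), (fun x => be1 (to_sub se (e x))); split.
  + exact: (rlin_comp (rlin_subm se) la1).
  + exact: (rlin_comp lb1 (rlin_to_sub se le ee)).
  + move=> v; have -> : to_sub se (e (subm_val (al1 v))) = al1 v; last exact: ba.
    apply: (subm_inj se); rewrite to_subK; [exact: (subm_mem (al1 v))|exact: ee].
  + move=> n x; have h y : subm_val (al1 (be1 (to_sub se (e y)))) = e y.
      by have /= -> := id1 (to_sub se (e y)); rewrite to_subK //; apply: ee.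
    by rewrite !h ce.
- move=> e e1 e2 _ ie1 ie2 eE _ _ H1 H2 al be la lb bij.
  case: ie1 => l1 _ _; case: ie2 => l2 _ _.
  have [|||||b1|b2] := bij_or (fun v => be (e1 (al v))) (fun v => be (e2 (al v))) => //.
  + exact: (rlin_comp lb (rlin_comp l1 la)).
  + exact: (rlin_comp lb (rlin_comp l2 la)).
  + by apply: (eq_bij bij) => v; rewrite eE (rlinD _ _ lb).
  + exact: (H1 al be).
  + exact: (H2 al be).
Qed.

End FinitelyGenerated.

(** * The module with a copy of M in every degree *)

Section Hat.
Variables (R : pzRingType) (rho : int -> R -> R) (d : nat).
Hypothesis hrho : ring_graded rho.
Hypothesis hd : supp_bound rho d.
Let grho : grading rho := hrho.1.
Variable M : rightModType R.

Let rho_sum r : r = \sum_(j <- win d) rho j r.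
Proof. by apply: (gr_sum grho) => n; apply: hd. Qed.

(** The product of copies of M, one in each degree; an element of degree j of R
    maps the copy in degree n to the copy in degree n + j. *)
Definition hat of ring_graded rho & supp_bound rho d : Type := int -> M.
Notation H := (hat hrho hd).
HB.instance Definition _ := GRing.Zmodule.copy H (int -> M).

Definition hat_scale (r : GRing.converse R) (h : H) : H :=
  fun n => \sum_(j <- win d) h (n - j) *> rho j r.

Lemma hat_addE (h k : H) n : (h + k) n = h n + k n.
Proof. by []. Qed.

Fact hat_scalerA a b h : hat_scale a (hat_scale b h) = hat_scale (a * b) h.
Proof.
apply: funext => n; rewrite /hat_scale.
under eq_bigr => j _ do rewrite ract_suml.
rewrite exchange_big /=.
have -> : \sum_(k <- win d) h (n - k) *> rho k (a * b) =
          \sum_(k <- win d) \sum_(i <- win d) h (n - k) *> (rho i b * rho (k - i) a).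
  apply: eq_bigr => k _; rewrite -ract_sumr; congr (_ *> _).
  rewrite -[a * b]/((b : R) * (a : R)) {1}(rho_sum b) mulr_suml (addf_sum (gr_add grho k)).
  by apply: eq_bigr => i _; rewrite rho_mul.
rewrite [RHS]exchange_big /=; apply: eq_bigr => i _.
pose F k := h (n - k) *> (rho i b * rho (k - i) a).
rewrite -/(F _) -(sum_win_shift (F := F) (b := d) (i := i)).
- apply: eq_bigr => j _; rewrite /F addrK -ractA.
  by have -> : n - (j + i) = n - j - i by lia.
- move=> k nz; apply: (hd (v := rho i b * rho (k - i) a)) => z; apply: nz.
  rewrite /F; have := hrho.2 i (k - i) b a.
  have -> : i + (k - i) = k by lia.
  by rewrite z => <-; rewrite ract0r.
- move=> k nz; apply: (hd (v := a)) => z; apply: nz.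
  by rewrite /F z mulr0 ract0r.
Qed.

Fact hat_scale1r : left_id 1 hat_scale.
Proof.
move=> h; apply: funext => n; rewrite /hat_scale (sum_win1 (i := 0)) //.
  by rewrite subr0 (rho_one hrho) eqxx ract1.
by move=> k /negPf k0; rewrite (rho_one hrho) k0 ract0r.
Qed.

Fact hat_scalerDr : right_distributive hat_scale +%R.
Proof.
move=> r h k; apply: funext => n; rewrite hat_addE /hat_scale -big_split.
by apply: eq_bigr => j _; rewrite hat_addE ractDl.
Qed.

Fact hat_scalerDl h : {morph hat_scale^~ h : a b / a + b}.
Proof.
move=> a b; apply: funext => n; rewrite hat_addE /hat_scale -big_split.
by apply: eq_bigr => j _ /=; rewrite -ractDr -(gr_add grho).
Qed.

HB.instance Definition _ := GRing.Zmodule_isLmodule.Build (GRing.converse R) H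
  hat_scalerA hat_scale1r hat_scalerDr hat_scalerDl.

Definition hatM : rightModType R := H.

Lemma hatE (h : hatM) (r : R) n : (h *> r) n = \sum_(j <- win d) h (n - j) *> rho j r.
Proof. by []. Qed.

Lemma hat_homog (h : hatM) j (r : R) n : (h *> rho j r) n = h (n - j) *> rho j r.
Proof.
rewrite hatE.
have [jd|jd] := boolP (`|j| <= d)%N.
  rewrite (sum_win1 jd) ?(gr_id grho) // => k kj.
  by rewrite (gr_orth grho) // ract0r.
have -> : rho j r = 0 by apply: contrapT => /hd; apply/negP.
by rewrite ract0r big1 // => k _; rewrite (gr0 grho) ract0r.
Qed.

Definition hat_proj (n : int) (h : hatM) : hatM := fun k => if k == n then h n else 0.
Definition hat_delta (n : int) (v : M) : hatM := fun k => if k == n then v else 0.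

Lemma hat_proj_add n : additivef (hat_proj n).
Proof.
by move=> h k; apply: funext => m; rewrite hat_addE /hat_proj; case: eqP; rewrite ?addr0.
Qed.

Lemma hat_proj_proj m n h : hat_proj m (hat_proj n h) = if m == n then hat_proj n h else 0.
Proof.
apply: funext => k; rewrite /hat_proj.
have [->|km] := eqVneq k m; first by case: eqVneq => // ->; rewrite eqxx.
by case: (eqVneq m n) => [<-|//]; rewrite (negPf km).
Qed.

Lemma hat_proj_ract i j h r :
  hat_proj (i + j) (hat_proj i h *> rho j r) = hat_proj i h *> rho j r.
Proof.
apply: funext => k; rewrite {1}/hat_proj !hat_homog.
case: (eqVneq k (i + j)) => [->//|kij]; rewrite /hat_proj.
by rewrite ifF ?ract0l //; lia.
Qed.

Lemma hat_delta_add n : additivef (hat_delta n).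
Proof.
by move=> h k; apply: funext => m; rewrite hat_addE /hat_delta; case: eqP; rewrite ?addr0.
Qed.

Lemma hat_delta_ract n v r m : (hat_delta n v *> r) m = v *> rho (m - n) r.
Proof.
rewrite hatE /hat_delta.
have [jd|jd] := boolP (`|m - n| <= d)%N.
  rewrite (sum_win1 jd) ?subKr ?eqxx // => k kmn.
  by rewrite ifF ?ract0l //; lia.
have -> : rho (m - n) r = 0 by apply: contrapT => /hd; apply/negP.
rewrite ract0r big_seq big1 // => k; rewrite mem_win => kd.
by rewrite ifF ?ract0l //; apply/negP => /eqP e; move: jd; lia.
Qed.

Lemma hat_delta_homog n v j (r : R) :
  hat_delta n v *> rho j r = hat_delta (n + j) (v *> rho j r).
Proof.
apply: funext => k; rewrite hat_homog /hat_delta.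
case: (eqVneq k (n + j)) => [->|h]; first by rewrite ifT //; lia.
by rewrite ifF ?ract0l //; lia.
Qed.

(** * The submodule generated by the copies of M in a window of degrees *)

Section Window.
Variables (k : nat) (g : 'I_k -> M).
Hypothesis hg : forall v : M, exists a : 'I_k -> R, v = \sum_(i < k) g i *> a i.
Variable L : nat.

Let gen (x : 'I_(L.*2.+1) * 'I_k) : hatM := hat_delta (x.1%:Z - L%:Z) (g x.2).

Definition window : set hatM := [set h | exists a, h = \sum_x gen x *> a x].

Lemma submod_window : submod window.
Proof.
split.
- by exists (fun=> 0); rewrite big1 // => x _; rewrite ract0r.
- move=> _ _ [a ->] [c ->]; exists (fun x => a x + c x).
  by rewrite -big_split; apply: eq_bigr => x _; rewrite ractDr.
- move=> _ r [a ->]; exists (fun x => a x * r).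
  by rewrite ract_suml; apply: eq_bigr => x _; rewrite ractA.
Qed.
Notation sW := submod_window.

Lemma fg_window : finitely_generated (subM sW).
Proof.
have genW x : window (gen x).
  exists (fun y => if y == x then 1 else 0).
  rewrite (bigD1 x) //= eqxx ract1 big1 ?addr0 // => y /negPf ->.
  by rewrite ract0r.
apply: (fg_of_finType (g := fun x => to_sub sW (gen x))) => v.
have [a ea] := subm_mem v; exists a; apply: (subm_inj sW).
rewrite (rlin_sum _ _ _ (rlin_subm sW)) ea; apply: eq_bigr => x _.
by rewrite (rlinM _ _ (rlin_subm sW)) to_subK.
Qed.

Lemma window_supp h n : window h -> h n <> 0 -> (`|n| <= L + d)%N.
Proof.
move=> [a ->] nz; rewrite leqNgt; apply/negP => nb; apply: nz.
have -> : (\sum_x gen x *> a x) n = \sum_x (gen x *> a x) n.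
  by elim/big_rec2: _ => // x u v _ <-; rewrite hat_addE.
rewrite big1 // => x _; rewrite hat_delta_ract.
have -> : rho (n - (x.1%:Z - L%:Z)) (a x) = 0; last by rewrite ract0r.
apply: contrapT => /hd; have := ltn_ord x.1; lia.
Qed.

Lemma window_proj : stable_under hat_proj window.
Proof.
move=> n _ [a ->]; rewrite (addf_sum (hat_proj_add n)).
exists (fun x : 'I_(L.*2.+1) * 'I_k => rho (n - (x.1%:Z - L%:Z)) (a x)); apply: eq_bigr => x _.
apply: funext => m; rewrite /hat_proj !hat_delta_ract.
case: (eqVneq m n) => [->|mn]; first by rewrite (gr_id grho).
by rewrite (gr_orth grho) ?ract0r //; lia.
Qed.

Lemma window_graded : mod_graded rho (sub_proj sW hat_proj).
Proof.
apply: sub_graded.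
- exact: window_proj.
- exact: hat_proj_add.
- exact: hat_proj_proj.
- move=> h Wh; exists (L + d)%N; apply: funext => n.
  have -> : (\sum_(m <- win (L + d)) hat_proj m h) n = \sum_(m <- win (L + d)) hat_proj m h n.
    by elim/big_rec2: _ => // x u v _ <-; rewrite hat_addE.
  rewrite /hat_proj.
  have [nb|nb] := boolP (`|n| <= L + d)%N.
    by rewrite (sum_win1 nb) ?eqxx // => m; rewrite eq_sym => /negPf->.
  have z : h n = 0 by apply: contrapT => /(window_supp Wh); apply/negP.
  by rewrite z big1 // => m _; case: eqP => // <-.
- exact: hat_proj_ract.
Qed.

Lemma window_delta n v : (`|n| + d <= L)%N -> window (hat_delta n v).
Proof.
move=> nL; have [a ->] := hg v.
rewrite (addf_sum (hat_delta_add n)); apply: submod_sum; first exact: sW.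
move=> i _.
rewrite (rho_sum (a i)) ract_sumr (addf_sum (hat_delta_add n)).
apply: (submod_sum_seq sW) => j; rewrite mem_win => jd.
have -> : hat_delta n (g i *> rho j (a i)) = hat_delta (n - j) (g i) *> rho j (a i).
  by rewrite hat_delta_homog subrK.
apply: (submodM _ sW).
have lt : (absz (n - j + L%:Z)%R < L.*2.+1)%N by lia.
exists (fun x => if x == (Ordinal lt, i) then 1 else 0).
rewrite (bigD1 (Ordinal lt, i)) //= eqxx ract1 big1 ?addr0 => [|x /negPf ->]; last first.
  by rewrite ract0r.
rewrite /gen /=; congr (hat_delta _ _); lia.
Qed.

End Window.

(** Let Q be the endomorphism cutting the window module at degree d. Its
    components extend to endomorphisms P n of the abelian group M, equal to 1
    for small n and to 0 for large n and satisfying P (n + j) (v r) = P n v r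
    for r of degree j. So does the shifted family P (n - 1), and the sum over n
    of the differences P (n - 1) - P n telescopes to 1. It is the composite
    of v |-> (P (n - 1) v - P n v)_n and of the sum of components. *)
Lemma retract_of_window (G : nat) : right_artinian R -> length_bound rho G ->
  finitely_generated M ->
  exists (X : rightModType R) (q : int -> X -> X) (s : M -> X) (t : X -> M),
  [/\ mod_graded rho q, finitely_generated X, rlin s, rlin t & forall v, t (s v) = v].
Proof.
move=> artR hG [k [g hg]].
(* P is 1 in degrees up to d and 0 from d + G on, and elements of R have degrees
   between - d and d. So if n and n + j do not both lie in one of these two
   ranges, then both lie between 0 and T. An element of M in degree n involves
   generators in degrees between n - d and n + d, whence L. *)
pose T : nat := (2 * d + G)%N; pose L : nat := (T + d)%N.
pose sW := submod_window g L.
pose W : set hatM := window g L.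
pose q := sub_proj sW hat_proj.
have hq : mod_graded rho q by apply: window_graded.
have fgX : finitely_generated (subM sW) by apply: fg_window.
have [Q [lQ cQ Q1 Q0]] := cut_endomorphism artR d%:Z hG hq fgX.
have Wd n v : (`|n| <= T)%N -> W (hat_delta n v).
  by move=> nT; apply: window_delta => //; rewrite /L leq_add2r.
pose dl n v := to_sub sW (hat_delta n v).
have dlE n v : (`|n| <= T)%N -> subm_val (dl n v) = hat_delta n v.
  by move=> nT; apply: to_subK; apply: Wd.
have qdl n v : (`|n| <= T)%N -> q n (dl n v) = dl n v.
  move=> nT; apply: (subm_inj sW); rewrite sub_projE ?dlE //; last exact: window_proj.
  by apply: funext => m; rewrite /hat_proj /hat_delta eqxx.
pose P (n : int) v : M := if n < 0 then v else
  if n <= T%:Z then (subm_val (Q (dl n v)) : hatM) n else 0.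
have P1 n v : n <= d%:Z -> P n v = v.
  move=> nd; rewrite /P; case: ltP => // n0; rewrite ifT; last by lia.
  have nT : (`|n| <= T)%N by lia.
  by rewrite -(qdl n v nT) Q1 // qdl // dlE // /hat_delta eqxx.
have P0 n v : d%:Z + G%:Z <= n -> P n v = 0.
  move=> nd; rewrite /P ifF; last by lia.
  case: leP => // nT'; have nT : (`|n| <= T)%N by lia.
  by rewrite -(qdl n v nT) Q0 // (rlin0 (rlin_subm sW)).
have addP n : additivef (P n).
  move=> x y; rewrite /P; case: ltP => // n0; case: leP => nT'; last by rewrite addr0.
  have nT : (`|n| <= T)%N by lia.
  have -> : dl n (x + y) = dl n x + dl n y.
    apply: (subm_inj sW); rewrite (rlinD _ _ (rlin_subm sW)) !dlE //; exact: hat_delta_add.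
  by rewrite (rlinD _ _ lQ) (rlinD _ _ (rlin_subm sW)).
have PM n j v r : P (n + j) (v *> rho j r) = P n v *> rho j r.
  have [jd|jd] := boolP (`|j| <= d)%N; last first.
    have -> : rho j r = 0 by apply: contrapT => /hd; apply/negP.
    by rewrite !ract0r (addf0 (addP _)).
  have [h1|h1] := boolP ((n <= d%:Z) && (n + j <= d%:Z)).
    by case/andP: h1 => ? ?; rewrite !P1.
  have [h0|h0] := boolP ((d%:Z + G%:Z <= n) && (d%:Z + G%:Z <= n + j)).
    by case/andP: h0 => ? ?; rewrite !P0 // ract0l.
  have [n0 nT m0 mT] : [/\ 0 <= n, n <= T%:Z, 0 <= n + j & n + j <= T%:Z].
    by rewrite /T; split; lia.
  rewrite /P ifF ?mT; last by lia.
  rewrite ifF ?nT; last by lia.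
  have nT' : (`|n| <= T)%N by lia.
  have mT' : (`|(n + j)%R| <= T)%N by lia.
  have -> : dl (n + j) (v *> rho j r) = dl n v *> rho j r.
    by apply: (subm_inj sW); rewrite (rlinM _ _ (rlin_subm sW)) !dlE // hat_delta_homog.
  rewrite (rlinM _ _ lQ) (rlinM _ _ (rlin_subm sW)) hat_homog.
  by have -> : n + j - j = n by lia.
pose f v : hatM := fun n => P (n - 1) v - P n v.
have lf : rlin f.
  split=> [x y|x r]; apply: funext => n.
    by rewrite hat_addE /f !addP opprD addrACA.
  rewrite hatE /f.
  under eq_bigr => j _ do rewrite ractBl -!PM.
  rewrite sumrB {1 2}(rho_sum r) !ract_sumr (addf_sum (addP (n - 1))) (addf_sum (addP n)).
  congr (_ - _); apply: eq_bigr => j _; last by rewrite subrK.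
  by have -> : n - j - 1 + j = n - 1 by lia.
have Wf v : W (f v).
  have -> : f v = \sum_(n <- win T) hat_delta n (P (n - 1) v - P n v).
    apply: funext => n.
    have -> : (\sum_(m <- win T) hat_delta m (P (m - 1) v - P m v)) n =
        \sum_(m <- win T) hat_delta m (P (m - 1) v - P m v) n.
      by elim/big_rec2: _ => // m x y _ <-; rewrite hat_addE.
    rewrite /hat_delta /f.
    have [nT|nT] := boolP (`|n| <= T)%N.
      by rewrite (sum_win1 nT) ?eqxx // => m; rewrite eq_sym => /negPf->.
    rewrite big_seq big1 => [|m]; last first.
      by rewrite mem_win; case: eqP nT => // -> /negPf->.
    have [nd|nd] := leP n 0.
      by rewrite !P1 ?subrr //; lia.
    by rewrite !P0 ?subrr //; move: nT; rewrite /T; lia.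
  apply: (submod_sum_seq sW) => n; rewrite mem_win => nT; exact: Wd.
have Wz (x : subM sW) n : (subm_val x : hatM) n <> 0 -> (`|n| <= L + d)%N.
  apply: window_supp; exact: (subm_mem x).
pose t (x : subM sW) : M := \sum_(n <- win (L + d)) (subm_val x : hatM) n.
exists (subM sW), q, (to_sub sW \o f), t; split => //.
- exact: rlin_to_sub.
- split=> [x y|x r]; first by rewrite /t -big_split.
  have Wxr n : ((subm_val x : hatM) *> r) n <> 0 -> (`|n| <= L + d)%N.
    by move=> nz; apply: (Wz (x *> r)); rewrite (rlinM _ _ (rlin_subm sW)).
  rewrite /t (rlinM _ _ (rlin_subm sW)) -(sum_win_widen (leq_addr d (L + d)) Wxr).
  under eq_bigr => n _ do rewrite hatE.
  rewrite exchange_big /= ract_suml [in RHS](rho_sum r).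
  under [RHS]eq_bigr => n _ do rewrite ract_sumr.
  rewrite [RHS]exchange_big /= big_seq [RHS]big_seq.
  apply: eq_bigr => j; rewrite mem_win => jd.
  pose F n := (subm_val x : hatM) n *> rho j r.
  have Fz n : F n <> 0 -> (`|n| <= L + d)%N.
    by move=> nz; apply: (Wz x) => z; apply: nz; rewrite /F z ract0l.
  rewrite -[RHS](sum_win_widen (F := F) (leq_addr d (L + d)) Fz).
  rewrite -(sum_win_shift (F := fun n => F (n - j)) (i := j)) => [|n /Fz|n /Fz]; try lia.
  by apply: eq_bigr => n _; rewrite addrK.
- move=> v; rewrite /t [(_ \o _) v]/(to_sub sW (f v)) to_subK; last exact: Wf.
  rewrite /f /win big_map.
  pose c (n : nat) := - P (n%:Z - (L + d)%N%:Z - 1) v.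
  rewrite (eq_bigr (fun n => c n.+1 - c n)) => [|n _]; last first.
    rewrite /c opprK [RHS]addrC; congr (_ - P _ v); lia.
  have := telescope_sumr c (leq0n ((L + d).*2.+1)); rewrite /index_iota subn0 => ->.
  rewrite /c P0 ?oppr0 ?opprK ?add0r ?P1 //.
    by lia.
  by rewrite /L /T; lia.
Qed.

End Hat.

(** * Gradability under a bound on graded lengths *)

Section Gradability.
Variables (R : pzRingType) (rho : int -> R -> R).
Hypothesis hrho : ring_graded rho.
Hypothesis artR : right_artinian R.

Lemma exists_supp_bound : exists d, supp_bound rho d.
Proof.
have fgR : finitely_generated (regr R).
  exists 1%N, (fun=> 1) => v; exists (fun=> v : R); rewrite big_ord1.
  by rewrite -[_ *> _]/((1 : R) * (v : R)) mul1r.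
exact: (ring_supp_bound hrho (regr_artinian artR) (fg_noetherian artR fgR)).
Qed.

(** A grading of the direct summand e M of M. Its projections are kept as maps on
    M, so that the gradings of two complementary summands can be added. *)
Definition grades (M : rightModType R) (e : M -> M) (pp : int -> M -> M) : Prop :=
  [/\ forall n, additivef (pp n),
      forall m n v, pp m (pp n v) = if m == n then pp n v else 0,
      exists b, supp_bound pp b /\ forall v, e v = \sum_(n <- win b) pp n v
    & forall i j v r, pp (i + j) (pp i v *> rho j r) = pp i v *> rho j r].

Lemma grades_absorb (M : rightModType R) (e : M -> M) pp : grades e pp ->
  (forall n v, pp n (e v) = pp n v) /\ (forall n v, e (pp n v) = pp n v).
Proof.
move=> [ap pp2 [b [sb eE]] _].
split=> n v.
  rewrite eE (addf_sum (ap n)).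
  under eq_bigr => m _ do rewrite pp2.
  have [nb|nb] := boolP (`|n| <= b)%N.
    by rewrite (sum_win1 nb) ?eqxx // => m; rewrite eq_sym => /negPf->.
  have z : pp n v = 0 by apply: contrapT => /sb; apply/negP.
  by rewrite z big1 // => m _; case: eqP => // <-.
rewrite eE; under eq_bigr => m _ do rewrite pp2.
have [nb|nb] := boolP (`|n| <= b)%N.
  by rewrite (sum_win1 nb) ?eqxx // => m /negPf->.
have z : pp n v = 0 by apply: contrapT => /sb; apply/negP.
by rewrite z big1 // => m _; case: eqP.
Qed.

Lemma grades_add (M : rightModType R) (e e1 e2 : M -> M) p1 p2 :
  (forall v, e v = e1 v + e2 v) -> (forall v, e1 (e2 v) = 0) -> (forall v, e2 (e1 v) = 0) ->
  grades e1 p1 -> grades e2 p2 -> grades e (fun n v => p1 n v + p2 n v).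
Proof.
move=> eE e12 e21 g1 g2.
have [a1 a1'] := grades_absorb g1; have [a2 a2'] := grades_absorb g2.
have [ap1 pp1 [b1 [s1 s1']] r1] := g1; have [ap2 pp2 [b2 [s2 s2']] r2] := g2.
have o12 m n v : p1 m (p2 n v) = 0 by rewrite -a2' -a1 e12 (addf0 (ap1 m)).
have o21 m n v : p2 m (p1 n v) = 0 by rewrite -a1' -a2 e21 (addf0 (ap2 m)).
split.
- by move=> n x y; rewrite ap1 ap2 addrACA.
- move=> m n v; rewrite ap1 ap2 pp1 pp2 o12 o21.
  by case: eqP => _; rewrite ?addr0 ?add0r.
- have w1 n v : p1 n v <> 0 -> (`|n| <= maxn b1 b2)%N by move/s1; lia.
  have w2 n v : p2 n v <> 0 -> (`|n| <= maxn b1 b2)%N by move/s2; lia.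
  exists (maxn b1 b2); split=> [n v|v].
    have [/eqP->|/eqP/w1//] := boolP (p1 n v == 0).
    by rewrite add0r; apply: w2.
  rewrite eE s1' s2' big_split; congr (_ + _).
    by rewrite (sum_win_widen (leq_maxl b1 b2)) // => n; apply: s1.
  by rewrite (sum_win_widen (leq_maxr b1 b2)) // => n; apply: s2.
- move=> i j v r.
  have z1 : p1 (i + j) (p2 i v *> rho j r) = 0 by rewrite -r2 o12.
  have z2 : p2 (i + j) (p1 i v *> rho j r) = 0 by rewrite -r1 o21.
  by rewrite ractDl ap1 ap2 r1 r2 z1 z2 addr0 add0r.
Qed.

(** Each indecomposable summand of M is a retract of a graded module, hence a
    graded retract of it, along which a grading can be transported. *)
Lemma graded_of_length_bound (G : nat) (M : rightModType R) :
  length_bound rho G -> finitely_generated M -> exists p, mod_graded rho (M := M) p.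
Proof.
move=> hG fgM; have [d hd] := exists_supp_bound.
have [X [q [s [t [hq fgX ls lt ts]]]]] := retract_of_window hrho hd artR hG fgM.
have gq := hq.1; have [b qb] := fg_supp_bound hrho hd hq fgX.
pose o (n : int) := @id M.
suff H e : idem o e -> exists pp, grades e pp.
  have [|pp [ap pp2 [c [_ sc]] rp]] := H id; first by split.
  by exists pp; split=> //; split=> // v; exists c; apply: sc.
have oadd n : additivef (o n) by [].
move: e; apply: (idem_ind (fg_artinian artR fgM) oadd).
- move=> e [le _ _] e0; exists (fun _ _ => 0); split.
  + by move=> n x y; rewrite addr0.
  + by move=> m n v; case: eqP.
  + by exists 0%N; split=> // v; rewrite e0 big1.
  + by move=> i j v r; rewrite ract0l.
- move=> e ie inde; have [le ce ee] := ie.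
  pose se := submod_fixed ie.
  have oe : stable_under o (fixed e) by [].
  have o1 n x : sub_proj se o n x = x by apply: (subm_inj se); rewrite sub_projE.
  pose ro := to_sub se \o e.
  have lro : rlin ro := rlin_to_sub se le ee.
  have li := rlin_subm se.
  have iro v : subm_val (ro v) = e v by rewrite /ro /= to_subK //; apply: ee.
  have roi x : ro (subm_val x) = x.
    by apply: (subm_inj se); rewrite iro; apply: (subm_mem x).
  have tsx x : (ro \o t) ((s \o subm_val) x) = x by rewrite /= ts roi.
  have [al [be [la lb ba cq]]] := graded_retract hrho artR o1 (fg_fixed ie fgM)
     (indec_sub se oe inde) hq fgX qb (rlin_comp ls li) (rlin_comp lro lt) tsx.
  pose th x := subm_val (be x); pose ta v := al (ro v).
  have lth : rlin th := rlin_comp li lb.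
  have lta : rlin ta := rlin_comp la lro.
  have tt n x : th (q n (ta (th x))) = th (q n x).
    by rewrite /th /ta roi -cq ba.
  exists (fun n v => th (q n (ta v))); split.
  + by move=> n x y; rewrite (rlinD _ _ lta) (gr_add gq) (rlinD _ _ lth).
  + move=> m n v; rewrite tt (gr_proj gq); case: eqP => // _; exact: rlin0.
  + exists b; split=> [n v nz|v].
      by apply: (qb n (ta v)) => z; apply: nz; rewrite z (rlin0 lth).
    rewrite -(rlin_sum _ _ _ lth) -(gr_sum gq); last by move=> n; apply: qb.
    by rewrite /th /ta ba iro.
  + move=> i j v r; rewrite -(rlinM _ _ lth) tt; congr th; exact: hq.2.
- by move=> e e1 e2 _ _ _ eE e12 e21 [p1 g1] [p2 g2]; eexists; apply: (grades_add eE e12 e21 g1 g2).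
Qed.

End Gradability.

(** * Suprema of extended integers *)

Section ExtendedIntegers.
Local Open Scope ereal_scope.

(** A set of extended integers that contains an integer and is bounded above by
    one has a greatest element. *)
Lemma ereal_int_supremums (A : set (\bar int)) : supremums A !=set0.
Proof.
have [ub|nub] := pselect (forall b : int, exists2 x, A x & b%:E < x).
  exists +oo; split=> [x _|u uA]; first exact: leey.
  case: u uA => // [r|] uA.
    by have [x Ax] := ub r; rewrite ltNge (uA x Ax).
  by have [x Ax] := ub 0%R; rewrite ltNge (le_trans (uA x Ax)) // leNye.
have [b hb] : exists b : int, forall x, A x -> x <= b%:E.
  apply: contrapT => H; apply: nub => b; apply: contrapT => nx; apply: H; exists b => x Ax.
  by rewrite leNgt; apply/negP => bx; apply: nx; exists x.
have [[r Ar]|nr] := pselect (exists r : int, A r%:E); last first.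
  exists -oo; split=> [x Ax|u _]; last exact: leNye.
  case: x Ax => // [r Ar|Ax]; first by case: nr; exists r.
  by have := hb _ Ax.
have ex : exists n : nat, `[< A (b - n%:Z)%:E >].
  exists `|b - r|%N; apply/asboolP.
  have := hb _ Ar; rewrite lee_fin => rb.
  by have -> : (b - `|(b - r)%R|%N%:Z = r)%R by lia.
case: (ex_minnP ex) => n /asboolP An minn.
exists (b - n%:Z)%:E; split=> [x Ax|u uA]; last exact: uA.
case: x Ax => [x Ax|Ax|_]; [|by have := hb _ Ax|exact: leNye].
have := hb _ Ax; rewrite !lee_fin => xb.
have /minn : `[< A (b - `|(b - x)%R|%N%:Z)%:E >].
  by apply/asboolP; have -> : (b - `|(b - x)%R|%N%:Z = x)%R by lia.
lia.
Qed.

Lemma ereal_int_infimums (A : set (\bar int)) : infimums A !=set0.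
Proof.
have [s [us ls]] := ereal_int_supremums [set - x | x in A].
exists (- s); split=> [x Ax|u uA].
  by rewrite leeNl; apply: us; exists x.
rewrite leeNr; apply: ls => _ [x Ax <-]; rewrite leeN2; exact: uA.
Qed.

End ExtendedIntegers.

(** * Bounds on graded lengths *)

Section Bounds.
Variables (R : pzRingType) (Rgr : int -> {pred R}) (rho : int -> R -> R).
Hypothesis rhoE : forall n x, x \in Rgr n <-> rho n x = x.

Lemma graded_length_ge (X : gradedModule Rgr) n m :
  degrees X n -> degrees X m -> ((n - m + 1)%:E <= graded_length X)%E.
Proof.
move=> Dn Dm; rewrite EFinD EFinB /graded_length.
apply: leeD2r; apply: leeB.
  by apply: ge_supremum_Nmem; [exact: ereal_int_supremums|exists n].
by apply: le_infimum_Nmem; [exact: ereal_int_infimums|exists m].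
Qed.

Lemma length_bound_of_sup :
  (sup_graded_length Rgr < +oo)%E -> exists G, length_bound rho G.
Proof.
move=> fin.
exists (absz (fine (sup_graded_length Rgr))) => Y p hp fgY indY n m v w nv mw.
have gp := hp.1.
pose X : gradedModule Rgr := graded_of_projections rhoE hp.
have XE k (x : X) : x \in gm_comp X k <-> p k x = x by split => [/eqP|/eqP].
have indX : graded_indecomposable X by exact: (@graded_indecomposable_of_indec R Rgr X p gp XE indY).
have D k x : p k x <> 0 -> degrees X k.
  by move=> /eqP nz; exists (p k x) => //; apply/XE; rewrite (gr_id gp).
have le1 := graded_length_ge (D _ _ nv) (D _ _ mw).
have le2 : (graded_length X <= sup_graded_length Rgr)%E.
  apply: ge_supremum_Nmem; first exact: ereal_int_supremums.
  by exists X; split.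
have := le_trans le1 le2; move: fin; case: (sup_graded_length Rgr) => //= r _.
rewrite lee_fin; lia.
Qed.

Lemma gradable_of_graded (M : rightModType R) p : mod_graded rho (M := M) p -> gradable Rgr M.
Proof.
move=> hp; exists (graded_of_projections rhoE hp).
by exists (idfun : {linear M -> M}); exists id.
Qed.

End Bounds.

Lemma module_iso_rlin (R : pzRingType) (M N : rightModType R) : module_iso M N ->
  exists (f : M -> N) (g : N -> M), [/\ rlin f, rlin g, cancel f g & cancel g f].
Proof.
move=> [f [g fg gf]]; have lf : rlin f by split=> [x y|x r]; [exact: linearD|exact: linearZ].
by exists f, g; split=> //; apply: rlin_inv lf fg gf.
Qed.

Section FiniteType.
Variables (R : pzRingType) (Rgr : int -> {pred R}) (rho : int -> R -> R).
Hypothesis hrho : ring_graded rho.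
Hypothesis rhoE : forall n x, x \in Rgr n <-> rho n x = x.
Hypothesis artR : right_artinian R.

Lemma indecomposable_of_graded (Y : rightModType R) (p : int -> Y -> Y) :
  mod_graded rho p -> finitely_generated Y -> indec p [set: Y] -> indecomposable Y.
Proof.
move=> hp fgY indY; have [d hd] := exists_supp_bound hrho artR.
have [b pb] := fg_supp_bound hrho hd hp fgY.
split; first by have [[v _ nv] _] := indY; exists v.
move=> A B sA sB [hs h0].
have sub (C : {pred Y}) : submod_closed C -> submod [set v | v \in C].
  move=> [C0 lC]; split=> //= [x y Cx Cy|x r Cx]; first by rewrite -[x]scale1r; apply: lC.
  by rewrite -[_ *> _]addr0; apply: lC.
pose o (n : int) := @id Y.
have oadd n : additivef (o n) by [].
have iid : idem o id by split.
have oC C : stable_under o C by [].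
have subT (C : set Y) : C `<=` fixed (@id Y) by [].
have [|e1 [e2 [[l1 _ e11] _ [eE _ _] eA eB]]] :=
  dsum_idem oadd iid (sub A sA) (sub B sB) (oC _) (oC _) (subT _) (subT _) _ h0.
  by move=> v _; have [a [c ?]] := hs v; exists a, c.
have z (C : {pred Y}) : submod_closed C -> (forall v, v \in C -> v = 0) -> C =i pred1 0.
  by move=> [C0 _] hC v; rewrite [RHS]inE; apply/idP/eqP => [/hC//|->].
have [e0|e1id] := idempotent_trivial hrho hp pb (fg_artinian artR fgY)
  (fg_noetherian artR fgY) indY l1 e11.
  by left; apply: z => // v Av; rewrite -(eA v Av) e0.
right; apply: z => // v Bv; have := eE v.
by rewrite e1id (eB v Bv) -{1}[v]addr0 => /addrI /esym.
Qed.

(** The length of an indecomposable graded module depends only on the isomorphism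
    class of the underlying module, which is indecomposable and gradable, so
    that only finitely many lengths occur. *)
Lemma length_bound_of_finite :
  finitely_many_up_to_iso (fun M : rightModType R =>
    [/\ finitely_generated M, indecomposable M & gradable Rgr M]) ->
  exists G, length_bound rho G.
Proof.
move=> [k [N hN]]; have [d hd] := exists_supp_bound hrho artR.
have /choice [G hG] (i : 'I_k) : exists G : nat, forall (Y : rightModType R) (p : int -> Y -> Y),
    mod_graded rho p -> finitely_generated Y -> indec p [set: Y] -> module_iso Y (N i) ->
    forall n m v w, p n v <> 0 -> p m w <> 0 -> n - m < G%:Z.
  have [[Z [q [hq fgZ indZ isoZ]]]|H] := pselect (exists (Z : rightModType R) (q : int -> Z -> Z),
    [/\ mod_graded rho q, finitely_generated Z, indec q [set: Z] & module_iso Z (N i)]); last first.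
    by exists 0%N => Y p hp fgY indY isoY; case: H; exists Y, p.
  have [c qc] := fg_supp_bound hrho hd hq fgZ.
  exists (2 * c + 1)%N => Y p hp fgY indY isoY n m v w nv mw.
  have [b pb] := fg_supp_bound hrho hd hp fgY.
  have [f [g [lf lg fg gf]]] := module_iso_rlin isoY.
  have [f' [g' [lf' lg' fg' gf']]] := module_iso_rlin isoZ.
  have FG : cancel (g' \o f) (g \o f') by move=> x; rewrite /= gf' fg.
  have [dl hdl] := iso_degrees hrho hp hq pb qc (fg_artinian artR fgY)
    (fg_noetherian artR fgY) indY (rlin_comp lg' lf) (rlin_comp lg lf') FG.
  have [v' /qc h1] := hdl n v nv; have [w' /qc h2] := hdl m w mw.
  lia.
exists (\max_(i < k) G i)%N => Y p hp fgY indY n m v w nv mw.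
have [i isoi] : exists i, module_iso Y (N i).
  apply: hN; split=> //; first exact: (indecomposable_of_graded hp).
  exact: (gradable_of_graded rhoE hp).
have h := hG i Y p hp fgY indY isoi n m v w nv mw.
have Gi : (G i <= \max_(j < k) G j)%N by apply: leq_bigmax.
by apply: (lt_le_trans h); rewrite lez_nat.
Qed.

End FiniteType.

Theorem theorem1p1 (R : pzRingType) (Rgr : int -> {pred R})
    (hgr : ring_grading Rgr) (hart : right_artinian R) :
  ((sup_graded_length Rgr < +oo)%E ->
     forall M : rightModType R, finitely_generated M -> gradable Rgr M) /\
  (finite_representation_type R <->
     finitely_many_up_to_iso (fun M : rightModType R =>
       [/\ finitely_generated M, indecomposable M & gradable Rgr M])) /\
  (finite_representation_type R ->
     forall M : rightModType R, finitely_generated M -> gradable Rgr M).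
Proof.
have [dR mR] := hgr; have [rho [grho rhoE]] := direct_sum_grading dR.
have hrho : ring_graded rho.
  split=> // i j x y; apply/rhoE; apply: mR; apply/rhoE; exact: (gr_id grho).
have key G (M : rightModType R) : length_bound rho G -> finitely_generated M -> gradable Rgr M.
  move=> hG fgM; have [p hp] := graded_of_length_bound hrho hart hG fgM.
  exact: (gradable_of_graded rhoE hp).
have fin_gr : finite_representation_type R -> finitely_many_up_to_iso
    (fun M : rightModType R => [/\ finitely_generated M, indecomposable M & gradable Rgr M]).
  by move=> [k [N hN]]; exists k, N => M [fgM indM _]; apply: hN.
split; last split; last first.
- move=> /fin_gr /(length_bound_of_finite hrho rhoE hart) [G hG] M; exact: (key G).
- split=> // fin; have [G hG] := length_bound_of_finite hrho rhoE hart fin.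
  have [k [N hN]] := fin; exists k, N => M [fgM indM]; apply: hN; split=> //.
  exact: (key G).
- move=> /(length_bound_of_sup rhoE) [G hG] M; exact: (key G).
Qed.
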